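(* Let $\pi_v$ and $\pi_{cv}$ be the vertex Tur\'an density and the coloured vertex Tur\'an density defined in the context, and let $R_2$, $C_6$, $B_3^-$, $B_3$, $B_4$, $B_5$ be as defined there. Then: (i) $\pi_v(R_2)=\pi_{cv}(B_3^-)=2/3$; (ii) $3/4\leq \pi_v(\mathcal{Q}_3)=\pi_{cv}(B_3)\leq 0.76900$; (iii) $1/2\leq \pi_v(C_6)=\pi_{cv}(B_4,B_5)\leq 0.53111$.
   Context: The $n$-dimensional hypercube $\mathcal{Q}_n$ is the graph with vertex set $\{0,1,\ldots,2^n-1\}$ in which $v_1v_2$ is an edge if and only if the binary representations of $v_1$ and $v_2$ differ in exactly one digit. For a family of graphs $\mathcal{F}$, a graph is $\mathcal{F}$-free if it contains no subgraph isomorphic to a member of $\mathcal{F}$. The vertex Tur\'an density is $\pi_v(\mathcal{F})=\lim_{n\to\infty}\max\{|V(G)|/|V(\mathcal{Q}_n)| : G \text{ is an } \mathcal{F}\text{-free induced subgraph of } \mathcal{Q}_n\}$ (this limit exists). $R_2$ is the graph obtained from $\mathcal{Q}_3$ by deleting one vertex, and $C_6$ is the cycle on $6$ vertices. A vertex-coloured hypercube $(n,\kappa)_v$ is $\mathcal{Q}_n$ together with a map $\kappa:V(\mathcal{Q}_n)\to\{\text{red},\text{blue}\}$. For vertex-coloured hypercubes $F_1=(n_1,\kappa_1)_v$, $F_2=(n_2,\kappa_2)_v$: $F_1$ is isomorphic to $F_2$ if there is a bijection $f:V(\mathcal{Q}_{n_1})\to V(\mathcal{Q}_{n_2})$ mapping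 edges to edges with $\kappa_1(v)=\kappa_2(f(v))$ for all $v$; $F_1$ is a subcube of $F_2$ if there is an injection $g:V(\mathcal{Q}_{n_1})\to V(\mathcal{Q}_{n_2})$ mapping edges to edges such that $\kappa_1(v)=\text{blue}$ implies $\kappa_2(g(v))=\text{blue}$. For a family $\mathcal{F}$ of vertex-coloured hypercubes, $H$ is $\mathcal{F}$-free if it has no subcube isomorphic to a member of $\mathcal{F}$. The vertex density of $(n,\kappa)_v$ is the fraction of its vertices coloured blue, and $\pi_{cv}(\mathcal{F})=\lim_{n\to\infty}\max_\kappa\{d_v((n,\kappa)_v): (n,\kappa)_v \text{ is } \mathcal{F}\text{-free}\}$ (this limit exists). $B_3$ is $\mathcal{Q}_3$ with all vertices blue; $B_3^-$ is $\mathcal{Q}_3$ with vertex $7$ red and all other vertices blue; $B_4$ is $\mathcal{Q}_3$ with vertices $5$ and $7$ red and the rest blue; $B_5$ is $\mathcal{Q}_3$ with vertices $0$ and $7$ red and the rest blue. *)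

(* Defs.v *)
From mathcomp Require Import all_boot all_order all_algebra.
From mathcomp Require Import boolp classical_sets reals.
From mathcomp Require Import topology normedtype sequences.

Set Implicit Arguments.
Unset Strict Implicit.
Unset Printing Implicit Defensive.

Import Order.TTheory GRing.Theory Num.Theory numFieldNormedType.Exports.

Local Open Scope ring_scope.

Record sgraph := SGraph {
  vertex :> finType;
  edge : rel vertex;
  edge_sym : symmetric edge;
  edge_irr : irreflexive edge }.

Definition isomorphic (G H : sgraph) : Prop :=
  exists2 f : G -> H, bijective f & {mono f : u v / edge u v}.

(* A subgraph is given by a set of vertices of G and a symmetric set of edges
   of G between these vertices. *)
Record subgraph (G : sgraph) := Subgraph {
  sub_vertices : {set G};
  sub_edge : rel G;
  sub_edge_sym : symmetric sub_edge;
  sub_edge_vertex : forall u v, sub_edge u v -> u \in sub_vertices;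
  sub_edge_edge : subrel sub_edge (@edge G) }.

Section GraphOfSubgraph.
Variables (G : sgraph) (H : subgraph G).
Let W := {v : G | v \in sub_vertices H}.
Let e : rel W := fun u v => sub_edge H (val u) (val v).

Fact graph_of_subgraph_sym : symmetric e.
Proof. by move=> u v; rewrite /e sub_edge_sym. Qed.

Fact graph_of_subgraph_irr : irreflexive e.
Proof.
by move=> u; apply/negP => /sub_edge_edge; rewrite edge_irr.
Qed.

Definition graph_of_subgraph : sgraph :=
  SGraph graph_of_subgraph_sym graph_of_subgraph_irr.
End GraphOfSubgraph.

Section Induced.
Variables (G : sgraph) (S : {set G}).
Let W := {v : G | v \in S}.
Let e : rel W := fun u v => edge (val u) (val v).

Fact induced_sym : symmetric e.
Proof. by move=> u v; rewrite /e edge_sym. Qed.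

Fact induced_irr : irreflexive e.
Proof. by move=> u; rewrite /e edge_irr. Qed.

Definition induced : sgraph := SGraph induced_sym induced_irr.
End Induced.

Definition graph_free (Fs : sgraph -> Prop) (G : sgraph) : Prop :=
  forall F : sgraph, Fs F ->
    ~ exists H : subgraph G, isomorphic (graph_of_subgraph H) F.

Definition digit (i v : nat) : bool := odd (v %/ 2 ^ i).

Section Hypercube.
Variable n : nat.

Definition cube_edge : rel 'I_(2 ^ n) :=
  fun u v => #|[set i : 'I_n | digit i u != digit i v]| == 1%N.

Fact cube_edge_sym : symmetric cube_edge.
Proof.
move=> u v; rewrite /cube_edge; congr (_ == _).
by apply: eq_card => i; rewrite !inE eq_sym.
Qed.

Fact cube_edge_irr : irreflexive cube_edge.
Proof.
by move=> u; rewrite /cube_edge eq_card0 // => i; rewrite !inE eqxx.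
Qed.

Definition hypercube : sgraph := SGraph cube_edge_sym cube_edge_irr.
End Hypercube.

(* The maximum is over a set of nonnegative numbers, so 0 is a neutral default;
   it is also the value when no induced subgraph is free, i.e. when Fs contains
   the graph without vertices. *)
Definition max_vertex_density (R : realType) (Fs : sgraph -> Prop) (n : nat) : R :=
  \big[Num.max/0]_(S : {set hypercube n}
                     | `[< graph_free Fs (induced S) >])
     (#|induced S|%:R / #|hypercube n|%:R).

Definition vertex_turan_density (R : realType) (Fs : sgraph -> Prop) : R :=
  lim (max_vertex_density R Fs @ \oo)%classic.

(* All choices of the deleted vertex give isomorphic graphs. *)
Definition R2 : sgraph :=
  induced [set v : hypercube 3 | nat_of_ord v != 7].

Section Cycle.
Variable k : nat.
Hypothesis k_ge3 : (3 <= k)%N.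

Definition cycle_edge : rel 'I_k := fun u v => (v == ordS u) || (u == ordS v).

Fact cycle_edge_sym : symmetric cycle_edge.
Proof. by move=> u v; rewrite /cycle_edge orbC. Qed.

Fact cycle_edge_irr : irreflexive cycle_edge.
Proof.
move=> u; rewrite /cycle_edge orbb; apply/negbTE/eqP => /(congr1 val) /=.
have := ltn_ord u; rewrite leq_eqVlt => /orP[/eqP uk|lt_uk].
  by rewrite uk modnn => u0; move: k_ge3; rewrite -uk u0.
by rewrite modn_small // => /eqP; rewrite eqn_leq ltnn andbF.
Qed.

Definition cycle_graph : sgraph := SGraph cycle_edge_sym cycle_edge_irr.
End Cycle.

Definition C6 : sgraph := @cycle_graph 6 isT.

Definition colour : finType := bool.
Definition red : colour := false.
Definition blue : colour := true.

Record coloured_cube := ColouredCube {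
  dim : nat;
  colouring : {ffun hypercube dim -> colour} }.

Definition cc_isomorphic (F1 F2 : coloured_cube) : Prop :=
  exists f : hypercube (dim F1) -> hypercube (dim F2),
    [/\ bijective f, {homo f : u v / edge u v} &
        forall v, colouring F1 v = colouring F2 (f v)].

Definition subcube (F1 F2 : coloured_cube) : Prop :=
  exists g : hypercube (dim F1) -> hypercube (dim F2),
    [/\ injective g, {homo g : u v / edge u v} &
        forall v, colouring F1 v = blue -> colouring F2 (g v) = blue].

Definition cc_free (Fs : coloured_cube -> Prop) (H : coloured_cube) : Prop :=
  forall F : coloured_cube, Fs F ->
    ~ exists K : coloured_cube, subcube K H /\ cc_isomorphic K F.

Definition vertex_density (R : realType) (F : coloured_cube) : R :=
  #|[set v | colouring F v == blue]|%:R / #|hypercube (dim F)|%:R.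

(* As above, 0 is the value when no colouring is free. *)
Definition max_coloured_density (R : realType) (Fs : coloured_cube -> Prop)
    (n : nat) : R :=
  \big[Num.max/0]_(kappa : {ffun hypercube n -> colour}
                     | `[< cc_free Fs (ColouredCube kappa) >])
     vertex_density R (ColouredCube kappa).

Definition coloured_turan_density (R : realType) (Fs : coloured_cube -> Prop) : R :=
  lim (max_coloured_density R Fs @ \oo)%classic.

Definition cube3_red (s : seq nat) : coloured_cube :=
  @ColouredCube 3 [ffun v => if nat_of_ord v \in s then red else blue].

Definition B3 : coloured_cube := cube3_red [::].
Definition B3m : coloured_cube := cube3_red [:: 7%N].
Definition B4 : coloured_cube := cube3_red [:: 5%N; 7%N].
Definition B5 : coloured_cube := cube3_red [:: 0%N; 7%N].

(* Both limits above exist, for arbitrary families: the maximum densities are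
   nonincreasing in n, because each half of a cube of dimension n + 1 is a cube
   of dimension n. *)

Lemma subgraph_isomorphicP (G F : sgraph) :
  (exists H : subgraph G, isomorphic (graph_of_subgraph H) F) <->
  (exists2 f : F -> G, injective f & {homo f : u v / edge u v}).
Proof.
split=> [[H [f [g fK gK] f_edge]]|[f f_inj f_edge]].
  exists (fun v => val (g v)) => [u v /val_inj /(can_inj gK)//|u v uv].
  by apply: (@sub_edge_edge _ H); have /= <- := f_edge (g u) (g v); rewrite !gK.
pose e := [rel x y | [exists u, exists v, [&& x == f u, y == f v & edge u v]]].
have eP x y : reflect (exists u v, [/\ x = f u, y = f v & edge u v]) (e x y).
  apply: (iffP existsP) => [[u /existsP[v /and3P[/eqP-> /eqP-> uv]]]|].
    by exists u, v.
  by move=> [u [v [-> -> uv]]]; exists u; apply/existsP; exists v; rewrite !eqxx.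
have e_sym : symmetric e.
  by move=> x y; apply/eP/eP => -[u [v [-> -> uv]]]; exists v, u;
     rewrite edge_sym.
have e_vert x y : e x y -> x \in f @: F.
  by move=> /eP[u [v [-> _ _]]]; apply: imset_f.
have e_edge : subrel e (@edge G) by move=> x y /eP[u [v [-> -> /f_edge]]].
pose H := Subgraph e_sym e_vert e_edge.
pose h (u : F) : graph_of_subgraph H :=
  exist (fun v => v \in f @: F) (f u) (imset_f f isT).
have h_bij : bijective h.
  apply: inj_card_bij; first by move=> u v [/f_inj].
  by rewrite card_sig -(card_imset _ f_inj) leq_eqVlt; apply/orP; left;
     apply/eqP/eq_card.
have h_edge : {mono h : u v / edge u v}.
  move=> u v; apply/eP/idP => [[u' [v' [/f_inj-> /f_inj-> //]]]|uv].
  by exists u, v.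
exists H; case: h_bij => k hK kH; exists k; first by exists h.
by move=> u v; rewrite -h_edge !kH.
Qed.

Section Halves.
Variable n : nat.

Fact half_subproof (b : bool) (v : 'I_(2 ^ n)) : (v + b * 2 ^ n < 2 ^ n.+1)%N.
Proof.
rewrite expnS mul2n -addnn -addSn leq_add //.
by case: b; rewrite ?mul1n.
Qed.

Definition half b (v : hypercube n) : hypercube n.+1 :=
  Ordinal (half_subproof b v).

Lemma half_inj b : injective (half b).
Proof. by move=> u v /(congr1 val)/= /addIn/val_inj. Qed.

Lemma digit_half b (v : 'I_(2 ^ n)) i :
  (i <= n)%N -> digit i (half b v) = if i == n then b else digit i v.
Proof.
rewrite /digit /=; case: v => v /= lt_v.
rewrite leq_eqVlt => /orP[/eqP->|lt_in].
  by rewrite eqxx addnC divnMDl ?expn_gt0 // divn_small // addn0; case: b.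
have -> : (2 ^ n = 2 ^ (n - i) * 2 ^ i)%N by rewrite -expnD subnK // ltnW.
rewrite (ltn_eqF lt_in) mulnA addnC.
rewrite divnMDl ?expn_gt0 // oddD oddM oddX.
by rewrite subn_eq0 leqNgt lt_in andbF.
Qed.

Lemma half_edge b : {mono half b : u v / edge u v}.
Proof.
move=> u v; rewrite /= /cube_edge; congr (_ == _).
rewrite -!sum1_card big_mkcond [RHS]big_mkcond big_ord_recr /=.
rewrite !inE !digit_half //= !eqxx addn0; apply: eq_bigr => i _.
rewrite !inE.
have -> : digit (widen_ord (leqnSn n) i) (half b u) = digit i u.
  by rewrite digit_half /= ?(ltnW (ltn_ord i)) // ltn_eqF.
have -> // : digit (widen_ord (leqnSn n) i) (half b v) = digit i v.
by rewrite digit_half /= ?(ltnW (ltn_ord i)) // ltn_eqF.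
Qed.

Lemma card_halves (S : {set hypercube n.+1}) :
  (#|S| <= #|half false @^-1: S| + #|half true @^-1: S|)%N.
Proof.
apply: leq_trans (leq_add (leq_imset_card (half false) _)
                          (leq_imset_card (half true) _)).
apply: leq_trans (leq_card_setU _ _); apply/subset_leq_card/fintype.subsetP => x Sx.
have [lt_x|le_x] := ltnP x (2 ^ n).
  have E : half false (Ordinal lt_x) = x by apply/val_inj; rewrite /= addn0.
  by rewrite inE -E imset_f // inE E.
have lt_x : (x - 2 ^ n < 2 ^ n)%N.
  by rewrite ltn_subLR // addnn -mul2n -expnS ltn_ord.
have E : half true (Ordinal lt_x) = x.
  by apply/val_inj; rewrite /= mul1n subnK.
by rewrite inE -E [X in _ || X]imset_f ?orbT // inE E.
Qed.

Lemma density_halves (R : realType) (S : {set hypercube n.+1}) (M : R) :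
  (forall b, #|half b @^-1: S|%:R / #|hypercube n|%:R <= M) ->
  #|S|%:R / #|hypercube n.+1|%:R <= M.
Proof.
have n_gt0 m : (0 : R) < #|hypercube m|%:R by rewrite ltr0n card_ord expn_gt0.
move=> le_M; rewrite ler_pdivrMr //.
have -> : #|hypercube n.+1|%:R = #|hypercube n|%:R + #|hypercube n|%:R :> R.
  by rewrite -natrD !card_ord expnS mul2n addnn.
apply: (@le_trans _ _ (#|half false @^-1: S| + #|half true @^-1: S|)%:R).
  by rewrite ler_nat card_halves.
by rewrite natrD mulrDr lerD // -ler_pdivrMr.
Qed.

End Halves.

Lemma max_vertex_density_ge0 (R : realType) (Fs : sgraph -> Prop) n :
  0 <= max_vertex_density R Fs n.
Proof. exact: bigmax_ge_id. Qed.

Lemma max_coloured_density_ge0 (R : realType) (Fs : coloured_cube -> Prop) n :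
  0 <= max_coloured_density R Fs n.
Proof. exact: bigmax_ge_id. Qed.

Lemma max_vertex_density_nonincreasing (R : realType) (Fs : sgraph -> Prop) n :
  max_vertex_density R Fs n.+1 <= max_vertex_density R Fs n.
Proof.
apply: bigmax_le => [|S /asboolP S_free]; first exact: max_vertex_density_ge0.
rewrite card_sig -cardsE /=.
have -> : [set x | x \in S]%SET = S by apply/setP => x; rewrite inE.
apply: density_halves => b.
have -> : #|half b @^-1: S| = #|induced (half b @^-1: S)|.
  by rewrite card_sig; apply: eq_card.
apply: (le_bigmax_cond 0
  (fun T : {set hypercube n} => #|induced T|%:R / #|hypercube n|%:R)).
apply/asboolP => F FsF /subgraph_isomorphicP[f f_inj f_edge].
apply: (S_free F FsF); apply/subgraph_isomorphicP.
have Sf u : half b (val (f u)) \in S by have := valP (f u); rewrite inE.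
exists (fun u => exist (fun v => v \in S) _ (Sf u)) => [u v [] /eqP|u v uv].
  by rewrite eqn_add2r => /eqP/val_inj/val_inj/f_inj.
have fuv : edge (val (f u)) (val (f v)) := f_edge _ _ uv.
by rewrite -(half_edge b) in fuv.
Qed.

Lemma max_coloured_density_nonincreasing (R : realType)
    (Fs : coloured_cube -> Prop) n :
  max_coloured_density R Fs n.+1 <= max_coloured_density R Fs n.
Proof.
apply: bigmax_le => [|k /asboolP k_free]; first exact: max_coloured_density_ge0.
apply: density_halves => b.
pose kb : {ffun hypercube n -> colour} := [ffun v => k (half b v)].
have -> : (half b @^-1: [set v | k v == blue] = [set v | kb v == blue])%SET.
  by apply/setP => v; rewrite !inE ffunE.
apply: (le_bigmax_cond 0
  (fun k' : {ffun hypercube n -> colour} =>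
     vertex_density R (ColouredCube k'))).
apply/asboolP => F FsF [K [[g [g_inj g_edge g_blue]] KF]].
apply: (k_free F FsF); exists K; split=> //.
exists (fun v => half b (g v)); split=> [u v /half_inj/g_inj//|u v uv|v Kv].
  by rewrite half_edge g_edge.
by have := g_blue v Kv; rewrite /= ffunE.
Qed.

Lemma vertex_turan_density_cvg (R : realType) (Fs : sgraph -> Prop) :
  cvgn (max_vertex_density R Fs).
Proof.
apply: nonincreasing_is_cvgn.
  by apply/nonincreasing_seqP => n; apply: max_vertex_density_nonincreasing.
by exists 0 => _ [n _ <-]; apply: max_vertex_density_ge0.
Qed.

Lemma coloured_turan_density_cvg (R : realType) (Fs : coloured_cube -> Prop) :
  cvgn (max_coloured_density R Fs).
Proof.
apply: nonincreasing_is_cvgn.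
  by apply/nonincreasing_seqP => n; apply: max_coloured_density_nonincreasing.
by exists 0 => _ [n _ <-]; apply: max_coloured_density_ge0.
Qed.

(* Main.v *)
(* The lower bounds come from deleting every m-th layer of the cube: a square
   meets three consecutive layers and a cube four, and some choice of the
   residue class deletes at most the average number of vertices. The equalities
   hold for every n: an embedding of R2, Q_3 or C_6 into Q_n lies in a
   3-dimensional subcube.

   The upper bounds are flag algebra arguments. For a vertex v and directions
   i, j, k, l of Q_n, not necessarily distinct, consider the colouring x of the
   4-cube that they span. Summed over all v, i, j, k, l,
     - a quadratic form in the colourings of the cubes (v, i, j, k) and
       (v, i, j, l) with a positive semidefinite matrix depending on the
       colouring of the face (v, i, j) gives a sum of squares, as does
     - a quadratic form in the colourings of the squares (v, i, j) and (v, k, l)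
       around a red vertex v.
   Adding such forms to the number of blue vertices of x, and symmetrizing,
   yields a function of x; its maximum over the colourings without forbidden
   subcubes bounds the density up to O(1/n), the error coming from repeated
   directions. The forms below were found by semidefinite programming, and the
   maximum is checked by evaluating all colourings of the 4-cube. For C_6 the
   colourings with a blue square are left out, since by B4-freeness all but O(1)
   of the squares on a given edge contain a red vertex. *)
From Stdlib Require Import ZArith.
From mathcomp Require Import ssrZ ring.
Require Import Defs.
From mathcomp Require Import all_boot all_order all_algebra.
From mathcomp Require Import boolp classical_sets reals.
From mathcomp Require Import topology normedtype sequences.
Import Order.TTheory GRing.Theory Num.Theory numFieldNormedType.Exports.
Set Implicit Arguments.
Unset Strict Implicit.
Unset Printing Implicit Defensive.
Local Open Scope ring_scope.

(** * Flips and subcubes *)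

Lemma nat_of_digits m v :
  (v < 2 ^ m)%N -> v = (\sum_(i < m) digit i v * 2 ^ i)%N.
Proof.
elim: m v => [|m IH] v; first by rewrite big_ord0 expn0 ltnS leqn0 => /eqP.
move=> lt_v; rewrite big_ord_recl /= {1}/digit expn0 divn1 muln1.
rewrite -[LHS]odd_double_half -mul2n; congr (_ + _)%N.
have lt_v2 : (v./2 < 2 ^ m)%N by rewrite -divn2 ltn_divLR // mulnC -expnS.
rewrite [in LHS](IH _ lt_v2) big_distrr /=; apply: eq_bigr => i _.
have -> : digit (bump 0 i) v = digit i v./2.
  by rewrite /digit /bump add1n expnS divnMA divn2.
by rewrite /bump add1n expnS mulnCA.
Qed.

Section Flip.
Variable n : nat.
Implicit Types (u v w : hypercube n) (i j k : 'I_n).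

Lemma vertex_ext u v : (forall i, digit i u = digit i v) -> u = v.
Proof.
move=> uv; apply: val_inj => /=.
rewrite (nat_of_digits (ltn_ord u)) (nat_of_digits (ltn_ord v)).
by apply: eq_bigr => i _; rewrite uv.
Qed.

(** Reading off the digits is injective, and vertices and digit patterns are equally many, so it is
    also onto. *)
Lemma vertex_of_digits (b : 'I_n -> bool) :
  exists v : hypercube n, forall i, digit i v = b i.
Proof.
pose bits v := [ffun i : 'I_n => digit i v].
have /inj_card_bij [] : injective bits.
  by move=> u v /ffunP uv; apply: vertex_ext => i; have := uv i; rewrite !ffunE.
  by rewrite card_ffun card_bool !card_ord.
move=> g _ gK; exists (g (finfun b)) => i.
by have /ffunP/(_ i) := gK (finfun b); rewrite !ffunE.
Qed.

(** Picked by its digits; the default [v] is never taken, since [vertex_of_digits] realises every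
    pattern. *)
Definition flip i v : hypercube n :=
  odflt v [pick w : hypercube n |
             [forall j : 'I_n, digit j w == (digit j v (+) (j == i))]].

Lemma digit_flip i v j : digit j (flip i v) = digit j v (+) (j == i).
Proof.
rewrite /flip; case: pickP => [w /forallP/(_ j)/eqP //|no_w].
have [w wE] := vertex_of_digits (fun j : 'I_n => digit j v (+) (j == i)).
by have /negP[] := no_w w; apply/forallP => k; rewrite wE.
Qed.

Lemma flipK i : involutive (flip i).
Proof. by move=> v; apply: vertex_ext => j; rewrite !digit_flip addbK. Qed.

Lemma flipC i j v : flip i (flip j v) = flip j (flip i v).
Proof. by apply: vertex_ext => k; rewrite !digit_flip addbAC. Qed.

Lemma edge_flipP u v : reflect (exists i, v = flip i u) (edge u v).
Proof.
apply: (iffP cards1P) => [] [i]; last first.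
  move=> ->; exists i; apply/setP => j.
  by rewrite !inE digit_flip; case: (digit j u); case: (j == i).
move=> /setP uv; exists i; apply: vertex_ext => j; rewrite digit_flip.
by have := uv j; rewrite !inE => <-; case: (digit j u); case: (digit j v).
Qed.

Lemma edge_flip i v : edge v (flip i v).
Proof. by apply/edge_flipP; exists i. Qed.

(** Reaching [w] through [i, a] and through [j, b] flips the same digits modulo 2, so either
    [a = i], or [a = j] and [b = i]. *)
Lemma common_neighbour u i j w : i != j ->
  edge (flip i u) w -> edge (flip j u) w -> w = u \/ w = flip j (flip i u).
Proof.
move=> ij /edge_flipP[a wa] /edge_flipP[b wb].
have E x : (x == a) (+) (x == i) = (x == b) (+) (x == j).
  have := congr1 (fun w : hypercube n => digit x w) (etrans (esym wa) wb).
  by rewrite /= !digit_flip -!addbA => /addbI; rewrite addbC => ->;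
    rewrite addbC.
have [ai|ai] := eqVneq a i; first by left; rewrite wa ai flipK.
right; rewrite wa; congr flip; apply/eqP.
have := E i; rewrite eqxx (negbTE ij) eq_sym (negbTE ai) /= addbF => /esym/eqP
  ib.
by have := E a; rewrite eqxx (negbTE ai) -ib (negbTE ai) /= => /esym.
Qed.

Definition toggle (b : bool) i v := if b then flip i v else v.

Lemma digit_toggle b i v j :
  digit j (toggle b i v) = digit j v (+) (b && (j == i)).
Proof. by case: b; rewrite /= ?addbF // digit_flip. Qed.

Lemma toggleC a b i j v :
  toggle a i (toggle b j v) = toggle b j (toggle a i v).
Proof. by apply: vertex_ext => k; rewrite !digit_toggle addbAC. Qed.

Definition corner i j k v (a b c : bool) :=
  toggle a i (toggle b j (toggle c k v)).

Definition cube_map i j k v (s : hypercube 3) : hypercube n :=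
  corner i j k v (digit 0 s) (digit 1 s) (digit 2 s).

End Flip.

Lemma edge3E (s t : hypercube 3) :
  edge s t = ((digit 0 s != digit 0 t) + (digit 1 s != digit 1 t)
              + (digit 2 s != digit 2 t) == 1)%N.
Proof.
rewrite /= /cube_edge -sum1_card big_mkcond /= !big_ord_recl big_ord0 !inE /=.
by rewrite /bump /= addn0 addnA; do 3![case: (_ != _)].
Qed.

Section CubeMap.
Variables (n : nat) (i j k : 'I_n) (v : hypercube n).

Lemma digit_corner a b c (x : 'I_n) :
  digit x (corner i j k v a b c) =
  digit x v (+) [&& a & x == i] (+) [&& b & x == j] (+) [&& c & x == k].
Proof.
rewrite /corner !digit_toggle.
by case: (digit x v); do 3![case: (_ && _)].
Qed.

Lemma flip_corner a b c :
  [/\ flip i (corner i j k v a b c) = corner i j k v (~~ a) b c,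
      flip j (corner i j k v a b c) = corner i j k v a (~~ b) c &
      flip k (corner i j k v a b c) = corner i j k v a b (~~ c)].
Proof.
split; apply: vertex_ext => x; rewrite digit_flip !digit_corner;
by move: (x == i) (x == j) (x == k) (digit x v) => [] [] [] [];
  case: a; case: b; case: c.
Qed.

Lemma cube_map_homo : {homo cube_map i j k v : s t / edge s t}.
Proof.
move=> s t; rewrite edge3E /cube_map => st.
suff [-> | -> | ->] : [\/ corner i j k v (digit 0 t) (digit 1 t) (digit 2 t)
       = flip i (corner i j k v (digit 0 s) (digit 1 s) (digit 2 s)),
     corner i j k v (digit 0 t) (digit 1 t) (digit 2 t)
       = flip j (corner i j k v (digit 0 s) (digit 1 s) (digit 2 s))
   | corner i j k v (digit 0 t) (digit 1 t) (digit 2 t)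
       = flip k (corner i j k v (digit 0 s) (digit 1 s) (digit 2 s))];
  [exact: edge_flip|exact: edge_flip|exact: edge_flip|].
have [-> -> ->] := flip_corner (digit 0 s) (digit 1 s) (digit 2 s).
move: (corner i j k v) => f.
move: st; case: (digit 0 s); case: (digit 0 t); case: (digit 1 s);
case: (digit 1 t); case: (digit 2 s); case: (digit 2 t) => //= _;
first [by constructor 1|by constructor 2|by constructor 3].
Qed.

Lemma cube_map_inj : i != j -> i != k -> j != k ->
  injective (cube_map i j k v).
Proof.
move=> ij ik jk s t st.
have E (x : 'I_n) : digit x (cube_map i j k v s) = digit x (cube_map i j k v t).
  by rewrite st.
have := (E i, E j, E k); rewrite /cube_map !digit_corner !eqxx !andbT.
rewrite (eq_sym j i) (eq_sym k i) (eq_sym k j).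
rewrite (negbTE ij) (negbTE ik) (negbTE jk) !andbF !addbF.
move=> [[/addbI s0 /addbI s1] /addbI s2].
by apply: vertex_ext => -[[|[|[|]]]].
Qed.

End CubeMap.

(** * Embeddings into cubes *)

Section Embeddings.
Variable n : nat.
Implicit Types (F : sgraph) (S : {set hypercube n}).

Definition embeds F S : Prop :=
  exists f : F -> hypercube n,
    [/\ injective f, {homo f : u v / edge u v} & forall u, f u \in S].

Lemma graph_free_inducedP (Fs : sgraph -> Prop) S :
  graph_free Fs (induced S) <-> forall F, Fs F -> ~ embeds F S.
Proof.
split=> S_free F FsF.
  move=> [f [f_inj f_edge fS]]; apply: (S_free F FsF).
  apply/subgraph_isomorphicP.
  exists (fun u => exist (fun v => v \in S) _ (fS u)) => [u v [/f_inj]//|u v].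
  exact: f_edge.
move=> /subgraph_isomorphicP[f f_inj f_edge]; apply: (S_free F FsF).
exists (fun u => val (f u)); split=> [u v /val_inj/f_inj//|u v uv|u].
  exact: (f_edge _ _ uv).
exact: (valP (f u)).
Qed.

Definition colour_set S : coloured_cube :=
  @ColouredCube n [ffun v => if v \in S then blue else red].

Lemma colouring_colour_set S v : (colouring (colour_set S) v = blue) <-> v \in
  S.
Proof. by rewrite /= ffunE; case: (v \in S). Qed.

End Embeddings.

(* A bijective homomorphism of cubes is an isomorphism, since it maps the
   finite set of edges injectively into a set of the same size. *)
Lemma cube_bij_mono n (f : hypercube n -> hypercube n) :
  bijective f -> {homo f : u v / edge u v} -> {mono f : u v / edge u v}.
Proof.
move=> f_bij f_edge; have f_inj := bij_inj f_bij.
pose E := [set p : hypercube n * hypercube n | edge p.1 p.2].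
pose ff (p : hypercube n * hypercube n) := (f p.1, f p.2).
have ff_inj : injective ff by move=> [a b] [c d] [/f_inj -> /f_inj ->].
have sub : ff @: E \subset E.
  by apply/fintype.subsetP => _ /imsetP[p pE ->]; move: pE;
    rewrite !inE => /f_edge.
have /eqP EE : ff @: E == E by rewrite eqEcard sub card_imset /=.
move=> u v; apply/idP/idP => [fuv|]; last exact: f_edge.
have : (f u, f v) \in ff @: E by rewrite EE inE.
by move=> /imsetP[[a b]]; rewrite inE /= => ab [/f_inj -> /f_inj ->].
Qed.

Lemma dim_eq m n (f : hypercube m -> hypercube n) : bijective f -> m = n.
Proof.
move=> /bij_eq_card; rewrite !card_ord => /eqP.
by rewrite eqn_exp2l // => /eqP.
Qed.

(** An embedding of [K] composed with the inverse of the isomorphism embeds [F]; that inverse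
    preserves edges by [cube_bij_mono]. *)
Lemma subcube_isoP (F H : coloured_cube) :
  (exists K : coloured_cube, subcube K H /\ cc_isomorphic K F) <-> subcube F H.
Proof.
split=> [|FH]; last first.
  by exists F; split=> //; exists id; split=> //; exists id.
move=> [[m k] [[g [g_inj g_edge g_blue]] [f [f_bij f_edge fE]]]].
case: F f f_bij f_edge fE => m' k' /= f f_bij.
(* The two dimensions are identified first, because [cube_bij_mono] speaks of maps from a cube to
   itself. *)
have E := dim_eq f_bij; case: m' / E k' f f_bij => k' f f_bij f_edge fE.
have f_mono := cube_bij_mono f_bij f_edge.
case: (f_bij) => h fK hK; exists (g \o h); split=> /=.
- by move=> u v /g_inj/(can_inj hK).
- by move=> u v uv; apply: g_edge; rewrite -f_mono !hK.
- by move=> v kv; apply: g_blue; rewrite /= fE hK.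
Qed.

Lemma cc_freeP (Fs : coloured_cube -> Prop) H :
  cc_free Fs H <-> forall F, Fs F -> ~ subcube F H.
Proof.
split=> H_free F FsF; first by move/subcube_isoP; apply: H_free.
by move/subcube_isoP; apply: H_free.
Qed.

Lemma cube3_redP n (S : {set hypercube n}) (r : seq nat) :
  subcube (cube3_red r) (colour_set S) <->
  exists g : hypercube 3 -> hypercube n,
    [/\ injective g, {homo g : u v / edge u v} &
        forall s : hypercube 3, (s : nat) \notin r -> g s \in S].
Proof.
split=> -[g [g_inj g_edge gS]]; exists g; split=> // s.
  move=> sr; apply/colouring_colour_set; apply: gS.
  by rewrite /= ffunE (negbTE sr).
rewrite /= ffunE; case: ifP => // /negbT sr _.
by apply/colouring_colour_set; apply: gS.
Qed.

(** * Equality of the vertex density and the coloured density *)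

Section Density.
Variable R : realType.
Variables (Fs : sgraph -> Prop) (Cs : coloured_cube -> Prop).
Hypothesis FsCs : forall n (S : {set hypercube n}),
  graph_free Fs (induced S) <-> cc_free Cs (colour_set S).

Lemma vertex_density_colour_set n (S : {set hypercube n}) :
  vertex_density R (colour_set S) = #|induced S|%:R / #|hypercube n|%:R.
Proof.
rewrite /vertex_density; congr (_%:R / _); rewrite card_sig.
by apply: eq_card => v; rewrite !inE ffunE; case: (v \in S).
Qed.

Lemma colour_set_preimage n (k : {ffun hypercube n -> colour}) :
  colour_set [set v | k v == blue] = ColouredCube k.
Proof.
congr ColouredCube; apply/ffunP => v; rewrite ffunE inE.
by case: (k v).
Qed.

(** Taking a vertex set as the blue class is a bijection that preserves density and freeness, so the
    two sequences agree term by term. *)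
Lemma turan_density_eq :
  vertex_turan_density R Fs = coloured_turan_density R Cs.
Proof.
congr (lim (_ @ \oo)%classic); apply/funext => n; apply/eqP.
rewrite eq_le; apply/andP; split.
  apply: bigmax_le => [|S /asboolP S_free];
    first exact: max_coloured_density_ge0.
  rewrite -vertex_density_colour_set.
  apply: (le_bigmax_cond 0
    (fun k : {ffun hypercube n -> colour} => vertex_density R (ColouredCube
      k))).
  by apply/asboolP; apply/FsCs.
apply: bigmax_le => [|k /asboolP k_free]; first exact: max_vertex_density_ge0.
rewrite -colour_set_preimage vertex_density_colour_set.
apply: (le_bigmax_cond 0
  (fun S : {set hypercube n} => #|induced S|%:R / #|hypercube n|%:R)).
by apply/asboolP; apply/FsCs; rewrite colour_set_preimage.
Qed.

End Density.

(** * Copies of R2, Q_3 and C_6 inside 3-dimensional subcubes *)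

Local Notation vtx m := (@Ordinal (2 ^ 3) m isT).

Lemma cube3_cases (P : hypercube 3 -> Prop) :
  [/\ P (vtx 0), P (vtx 1), P (vtx 2) & P (vtx 3)] ->
  [/\ P (vtx 4), P (vtx 5), P (vtx 6) & P (vtx 7)] -> forall s, P s.
Proof.
move=> [P0 P1 P2 P3] [P4 P5 P6 P7] [[|[|[|[|[|[|[|[|m]]]]]]]] lt_m] //.
all: by rewrite (bool_irrelevance lt_m isT).
Qed.

(* The four vertices at distance at most one from the origin determine the
   others, because two vertices at distance two have two common neighbours. *)
Lemma embedding_frame n (f : hypercube 3 -> hypercube n) :
  {in [pred s : hypercube 3 | (s : nat) != 7] &, injective f} ->
  {in [pred s : hypercube 3 | (s : nat) != 7] &, {homo f : s t / edge s t}} ->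
  exists i j k, [/\ i != j, i != k, j != k &
    forall s : hypercube 3, (s : nat) != 7 ->
      f s = cube_map i j k (f (vtx 0)) s].
Proof.
move=> f_inj f_edge.
have neq (s t : hypercube 3) : (s : nat) != 7 -> (t : nat) != 7 -> s != t -> f
  s != f t.
  by move=> s7 t7; apply: contraNneq => /(f_inj _ _ s7 t7) ->.
have edg (s t : hypercube 3) : (s : nat) != 7 -> (t : nat) != 7 -> edge s t ->
  edge (f s) (f t).
  by move=> s7 t7; apply: f_edge.
have /edge_flipP[i f1] : edge (f (vtx 0)) (f (vtx 1)) by apply: edg;
  rewrite ?edge3E.
have /edge_flipP[j f2] : edge (f (vtx 0)) (f (vtx 2)) by apply: edg;
  rewrite ?edge3E.
have /edge_flipP[k f4] : edge (f (vtx 0)) (f (vtx 4)) by apply: edg;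
  rewrite ?edge3E.
have ij : i != j.
  by apply: contraTneq (neq (vtx 1) (vtx 2) isT isT isT) => ij;
    rewrite f1 f2 ij eqxx.
have ik : i != k.
  by apply: contraTneq (neq (vtx 1) (vtx 4) isT isT isT) => ik;
    rewrite f1 f4 ik eqxx.
have jk : j != k.
  by apply: contraTneq (neq (vtx 2) (vtx 4) isT isT isT) => jk;
    rewrite f2 f4 jk eqxx.
have f3 : f (vtx 3) = flip j (flip i (f (vtx 0))).
  have [E|//] : f (vtx 3) = f (vtx 0) \/ f (vtx 3) = flip j (flip i (f (vtx
    0))).
    by apply: common_neighbour => //; rewrite -?f1 -?f2; apply: edg;
      rewrite ?edge3E.
  by have := neq (vtx 3) (vtx 0) isT isT isT; rewrite E eqxx.
have f5 : f (vtx 5) = flip k (flip i (f (vtx 0))).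
  have [E|//] : f (vtx 5) = f (vtx 0) \/ f (vtx 5) = flip k (flip i (f (vtx
    0))).
    by apply: common_neighbour => //; rewrite -?f1 -?f4; apply: edg;
      rewrite ?edge3E.
  by have := neq (vtx 5) (vtx 0) isT isT isT; rewrite E eqxx.
have f6 : f (vtx 6) = flip k (flip j (f (vtx 0))).
  have [E|//] : f (vtx 6) = f (vtx 0) \/ f (vtx 6) = flip k (flip j (f (vtx
    0))).
    by apply: common_neighbour => //; rewrite -?f2 -?f4; apply: edg;
      rewrite ?edge3E.
  by have := neq (vtx 6) (vtx 0) isT isT isT; rewrite E eqxx.
exists i, j, k; split=> //; apply: cube3_cases; split=> // _.
- by rewrite f3 flipC.
- by rewrite f5 flipC.
- by rewrite f6 flipC.
Qed.

(** A copy of R2 has a frame, and the cube spanned by the frame extends it; only the image of vertex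
    7 may leave [S], as [B3m] permits. *)
Lemma free_R2_B3m n (S : {set hypercube n}) :
  graph_free (fun F => F = R2) (induced S) <->
  cc_free (fun F => F = B3m) (colour_set S).
Proof.
rewrite graph_free_inducedP cc_freeP.
split=> S_free _ ->.
  move=> /(cube3_redP _ [:: 7%N])[g [g_inj g_edge gS]]; apply: (S_free _ erefl).
  exists (fun u => g (val u)); split=> [u v /g_inj/val_inj//|u v uv|u].
    exact: g_edge.
  by apply: gS; have := valP u; rewrite !inE.
move=> [f [f_inj f_edge fS]]; apply: (S_free _ erefl);
  apply/(cube3_redP _ [:: 7%N]).
pose dom (s : hypercube 3) := s \in [set v : hypercube 3 | nat_of_ord v != 7].
have dom0 : dom (vtx 0) by rewrite /dom inE.
(* At vertex 7 this takes the image of vertex 0, a dummy value that [embedding_frame] never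
   inspects. *)
pose f' (s : hypercube 3) := f (insubd (exist _ (vtx 0) dom0 : R2) s).
have f'_dom (s : hypercube 3) : (s : nat) != 7 -> val (insubd (exist _ (vtx 0)
  dom0 : R2) s) = s.
  by move=> s7; rewrite val_insubd inE s7.
have [||i [j [k [ij ik jk fE]]]] := @embedding_frame n f'.
- by move=> s t s7 t7 /f_inj/(congr1 val); rewrite !f'_dom.
- by move=> s t s7 t7 st; apply: f_edge; rewrite /= !f'_dom.
exists (cube_map i j k (f' (vtx 0))); split=> [||s].
- exact: cube_map_inj.
- exact: cube_map_homo.
- by rewrite inE => s7; rewrite -fE // fS.
Qed.

Lemma free_Q3_B3 n (S : {set hypercube n}) :
  graph_free (fun F => F = hypercube 3) (induced S) <->
  cc_free (fun F => F = B3) (colour_set S).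
Proof.
rewrite graph_free_inducedP cc_freeP; split=> S_free _ ->.
  move=> /(cube3_redP _ [::])[g [g_inj g_edge gS]]; apply: (S_free _ erefl).
  by exists g; split=> // u; apply: gS.
move=> [f [f_inj f_edge fS]]; apply: (S_free _ erefl);
  apply/(cube3_redP _ [::]).
by exists f; split=> // s _; apply: fS.
Qed.

Lemma C6_in_cube (h : 6.-tuple (hypercube 3)) :
  uniq h -> (forall m : 'I_6, edge (tnth h m) (tnth h (ordS m))) ->
  injective (tnth h) /\
  {homo (tnth h : C6 -> hypercube 3) : u v / edge u v}.
Proof.
move=> /tuple_uniqP h_inj h_edge; split=> // u v /orP[] /eqP ->;
  first exact: h_edge.
by rewrite edge_sym.
Qed.

Lemma free_C6_of_cube n (S : {set hypercube n}) (r : seq nat)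
    (h : 6.-tuple (hypercube 3)) :
  uniq h -> (forall m : 'I_6, edge (tnth h m) (tnth h (ordS m))) ->
  (forall m : 'I_6, (tnth h m : nat) \notin r) ->
  subcube (cube3_red r) (colour_set S) -> embeds C6 S.
Proof.
move=> h_uniq h_edge hr /cube3_redP[g [g_inj g_edge gS]].
have [h_inj h_homo] := C6_in_cube h_uniq h_edge.
exists (fun u : C6 => g (tnth h u)); split=> [u v /g_inj/h_inj//|u v uv|u].
  by apply: g_edge; apply: h_homo.
exact: gS.
Qed.

Lemma cube_map_cases n (i j k : 'I_n) v (P : nat -> hypercube n -> Prop) :
  [/\ P 0%N v, P 1%N (flip i v),
    P 2%N (flip j v) & P 3%N (flip i (flip j v))] ->
  [/\ P 4%N (flip k v), P 5%N (flip i (flip k v)), P 6%N (flip j (flip k v))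
    & P 7%N (flip i (flip j (flip k v)))] ->
  forall s : hypercube 3, P s (cube_map i j k v s).
Proof.
move=> [P0 P1 P2 P3] [P4 P5 P6 P7].
by apply: (@cube3_cases (fun s => P s (cube_map i j k v s))); split.
Qed.

(* Equalities between products of flips are equalities of digits modulo 2. *)
Ltac flips := let x := fresh "x" in
  apply: vertex_ext => x; rewrite !digit_flip;
  repeat match goal with |- context [eq_op x ?y] => case: (x == y) end;
  by case: (digit x _).

(** From [v] the hexagon follows the directions [a], [c], [e] one way and [b], [d], [g] the other
    way, up to the opposite vertex. So the two triples agree modulo 2 and only three directions
    occur: the hexagon bounds two squares with a common edge, or misses an antipodal pair of a
    3-cube. *)
Lemma cube_of_C6 n (S : {set hypercube n}) : embeds C6 S ->
  subcube B4 (colour_set S) \/ subcube B5 (colour_set S).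
Proof.
have flip_in (A : {set hypercube n}) u w : u \in A -> w = u -> w \in A.
  by move=> uA ->.
have B4I i j k v : i != j -> i != k -> j != k ->
    [/\ v \in S, flip i v \in S, flip j v \in S
      & flip i (flip j v) \in S] -> flip k v \in S ->
    flip j (flip k v) \in S -> subcube B4 (colour_set S).
  move=> ij ik jk [S0 S1 S2 S3] S4 S6; apply/(cube3_redP _ [:: 5; 7]%N).
  exists (cube_map i j k v); split; [exact: cube_map_inj|exact: cube_map_homo|].
  by apply: (@cube_map_cases _ i j k v (fun m w => m \notin _ -> w \in S));
    split.
have B5I i j k v : i != j -> i != k -> j != k ->
    [/\ flip i v \in S, flip j v \in S & flip i (flip j v) \in S] ->
    [/\ flip k v \in S, flip i (flip k v) \in S & flip j (flip k v) \in S] ->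
    subcube B5 (colour_set S).
  move=> ij ik jk [S1 S2 S3] [S4 S5 S6]; apply/(cube3_redP _ [:: 0; 7]%N).
  exists (cube_map i j k v); split; [exact: cube_map_inj|exact: cube_map_homo|].
  by apply: (@cube_map_cases _ i j k v (fun m w => m \notin _ -> w \in S));
    split.
move=> [f [f_inj f_edge fS]].
pose o m (lt_m : (m < 6)%N) : C6 := Ordinal lt_m.
have neq u v : u != v -> f u != f v by apply: contraNneq => /f_inj ->.
have /edge_flipP[a E1] : edge (f (@o 0 isT)) (f (@o 1 isT)) by apply: f_edge.
have /edge_flipP[c E2] : edge (f (@o 1 isT)) (f (@o 2 isT)) by apply: f_edge.
have /edge_flipP[e E3] : edge (f (@o 2 isT)) (f (@o 3 isT)) by apply: f_edge.
have /edge_flipP[b E5] : edge (f (@o 0 isT)) (f (@o 5 isT)) by apply: f_edge.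
have /edge_flipP[d E4] : edge (f (@o 5 isT)) (f (@o 4 isT)) by apply: f_edge.
have /edge_flipP[g E3'] : edge (f (@o 4 isT)) (f (@o 3 isT)) by apply: f_edge.
have := (neq (@o 1 isT) (@o 5 isT) isT, neq (@o 2 isT) (@o 0 isT) isT,
         neq (@o 4 isT) (@o 0 isT) isT, neq (@o 3 isT) (@o 1 isT) isT,
         neq (@o 3 isT) (@o 5 isT) isT, neq (@o 2 isT) (@o 4 isT) isT).
have := (fS (@o 0 isT), fS (@o 1 isT), fS (@o 2 isT), fS (@o 3 isT),
         fS (@o 4 isT), fS (@o 5 isT)).
move: (f (@o 0 isT)) (f (@o 1 isT)) (f (@o 2 isT)) (f (@o 3 isT)) (f (@o 4 isT))
  (f (@o 5 isT)) E1 E2 E3 E5 E4 E3' => v f1 f2 f3 f4 f5 -> -> -> -> -> E3'.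
move=> [[[[[S0 S1] S2] S3] S4] S5] [[[[[f15 f20] f40] f31] f35] f24].
have ab : a != b by apply: contraNneq f15 => ->.
have ca : c != a by apply: contraNneq f20 => ->; rewrite flipK.
have db : d != b by apply: contraNneq f40 => ->; rewrite flipK.
have ec : e != c by apply: contraNneq f31 => ->; rewrite flipK.
have gd : g != d by apply: contraNneq f35 => gd; rewrite E3' gd flipK.
have E x : (x == a) (+) (x == c) (+) (x == e)
           = (x == b) (+) (x == d) (+) (x == g).
  have := congr1 (fun w : hypercube n => digit x w) E3'.
  by rewrite /= !digit_flip -!addbA => /addbI.
have [ea|ea] := eqVneq e a.
  have dc : d = c.
    apply/eqP; have := E d;
      rewrite ea eqxx (negbTE db) (eq_sym d g) (negbTE gd).
    by case: (d == a); case: (d == c).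
  rewrite ea in S3; rewrite dc in S4 db.
  left; apply: (B4I a c b v) => //; rewrite 1?eq_sym //.
  - by split=> //; [apply: flip_in S3 _; flips|rewrite flipC].
(* With [g = b] the right side of [E] reduces to the single direction [d], while [a], [c], [e] are
   now three distinct ones. *)
have gb : g != b.
  apply/eqP => gb; have := E a; have := E c; rewrite gb !eqxx.
  rewrite (negbTE ca) (eq_sym a c) (negbTE ca) (eq_sym a e) (negbTE ea).
  rewrite (eq_sym c e) (negbTE ec) (negbTE ab).
  case: (c == b); case: (eqVneq c d) => //= cd _;
    case: (eqVneq a d) => //= ad _;
    by rewrite cd ad eqxx in ca.
have := E b; rewrite eqxx (eq_sym b a) (negbTE ab) (eq_sym b d) (negbTE db).
rewrite (eq_sym b g) (negbTE gb) /=.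
have := E d; rewrite eqxx (negbTE db) (eq_sym d g) (negbTE gd) /=.
(* By [E b], the direction [b] is exactly one of [c] and [e]; by [E d], an odd number of [a], [c],
   [e] equal [d]. *)
have [bc|bc] := eqVneq b c => /=.
  have [be|be] := eqVneq b e => //=.
  rewrite -bc (negbTE db) addbF => dae _.
  have de : d = e.
    apply/eqP; move: dae; case: (eqVneq d a) => [da|_]; last by case: (d == e).
    by rewrite da -bc flipC eqxx in f24.
  rewrite -bc -de in S2 S3 ca ea ec *; left.
  apply: (B4I b a d (flip b v)) => //; rewrite 1?eq_sym //.
  - split=> //; first by rewrite flipK.
      by rewrite flipC.
    by apply: flip_in S1 _; flips.
  - by apply: flip_in S3 _; flips.
have [be|be] := eqVneq b e => //=.
rewrite -be in S3 ea ec *; rewrite (negbTE db) addbF => dac _.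
(* If [d = c], the hexagon misses [flip c v] and its antipode [flip a (flip b v)]; otherwise it
   bounds two adjacent squares. *)
have [dc|dc] := eqVneq d c.
  rewrite dc in S4 db *; right.
  apply: (B5I a c b (flip c v)); rewrite 1?eq_sym //; split.
  - by apply: flip_in S2 _; flips.
  - by apply: flip_in S0 _; flips.
  - by apply: flip_in S1 _; flips.
  - by apply: flip_in S4 _; flips.
  - by apply: flip_in S3 _; flips.
  - by apply: flip_in S5 _; flips.
have da : d = a by apply/eqP; move: dac; rewrite (negbTE dc) addbF.
rewrite da in S4; left.
apply: (B4I a b c (flip a v)) => //; first by rewrite eq_sym.
by split=> //; [apply: flip_in S0 _|apply: flip_in S4 _|apply: flip_in S5 _];
  flips.
Qed.

Lemma free_C6_B4_B5 n (S : {set hypercube n}) :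
  graph_free (fun F => F = C6) (induced S) <->
  cc_free (fun F => F = B4 \/ F = B5) (colour_set S).
Proof.
rewrite graph_free_inducedP cc_freeP; split=> [S_free F FE FS|S_free _ -> CS].
  apply: (S_free _ erefl); case: FE FS => ->.
  (* The boundary of the two squares on the edge from 0 to 2; below, the hexagon of all vertices
     other than 0 and 7. *)
  - apply: (@free_C6_of_cube _ _ _
      [tuple vtx 0; vtx 1; vtx 3; vtx 2; vtx 6; vtx 4]) => //.
      by case=> [[|[|[|[|[|[|]]]]]] ?] //; rewrite edge3E.
    by case=> [[|[|[|[|[|[|]]]]]] ?].
  - apply: (@free_C6_of_cube _ _ _
      [tuple vtx 1; vtx 3; vtx 2; vtx 6; vtx 4; vtx 5]) => //.
      by case=> [[|[|[|[|[|[|]]]]]] ?] //; rewrite edge3E.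
    by case=> [[|[|[|[|[|[|]]]]]] ?].
by have [/S_free|/S_free] := cube_of_C6 CS; apply; [left|right].
Qed.

(** * Layers *)

Section Layers.
Variable n : nat.
Implicit Types (v : hypercube n) (i j k : 'I_n).

Definition weight v : nat := (\sum_(i < n) digit i v)%N.

Lemma weight_flip i v : ~~ digit i v -> weight (flip i v) = (weight v).+1.
Proof.
move=> iv; rewrite /weight (bigD1 i) //= [in RHS](bigD1 i) //=.
rewrite digit_flip eqxx (negbTE iv) /= add0n add1n; congr _.+1.
by apply: eq_bigr => j /negbTE ji; rewrite digit_flip ji addbF.
Qed.

Lemma odd_weight_flip i v : odd (weight (flip i v)) = ~~ odd (weight v).
Proof.
have [iv|iv] := boolP (digit i v); last by rewrite weight_flip.
by rewrite -[in RHS](flipK i v) (@weight_flip i (flip i v)) ?digit_flip ?eqxx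
  ?iv //= negbK.
Qed.

Definition off_layers (m r : nat) : {set hypercube n} :=
  [set v : hypercube n | (weight v %% m)%N != r].

(** Each vertex is deleted for exactly one residue, so the [m] sets have total size [m.-1 * 2 ^ n],
    and the largest reaches the average. *)
Lemma off_layers_dense m : (0 < m)%N ->
  exists2 r, (r < m)%N & (m.-1 * 2 ^ n <= m * #|off_layers m r|)%N.
Proof.
move=> m_gt0.
have tot : (\sum_(r < m) #|off_layers m r| = m.-1 * 2 ^ n)%N.
  under eq_bigr => r _ do rewrite -sum1_card big_mkcond /=.
  rewrite exchange_big /=; under eq_bigr => v _.
    under eq_bigr => r _ do rewrite inE.
    have lt_r := ltn_pmod (weight v) m_gt0.
    rewrite (bigD1 (Ordinal lt_r)) //= eqxx add0n.
    rewrite (eq_bigr (fun _ => 1%N)) => [|r]; last first.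
      by rewrite -val_eqE eq_sym /= => ->.
    rewrite sum1_card.
    have -> : #|[pred r : 'I_m | r != Ordinal lt_r]| = m.-1.
      by rewrite cardC1 card_ord.
    over.
  by rewrite sum_nat_const card_ord mulnC.
suff [r rP] : exists r : 'I_m, (m.-1 * 2 ^ n <= m * #|off_layers m r|)%N.
  by exists r.
apply/existsP; apply: contraT; rewrite negb_exists => /forallP no_r.
have : (\sum_(r < m) (m * #|off_layers m r|).+1 <= \sum_(r < m) m.-1 * 2 ^ n)%N.
  by apply: leq_sum => r _; rewrite ltnNge no_r.
under eq_bigr => r _ do rewrite -addn1.
rewrite big_split /= -big_distrr /= tot !sum_nat_const card_ord muln1.
by rewrite -[leqRHS]addn0 leq_add2l leqNgt m_gt0.
Qed.

Lemma residue_hit m r w : (r < m)%N -> exists2 t,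
  (t < m)%N & ((w + t) %% m)%N = r.
Proof.
move=> lt_r; have m_gt0 : (0 < m)%N by apply: leq_ltn_trans lt_r.
exists ((r + (m - w %% m)) %% m)%N; first exact: ltn_pmod.
have le_m : (w %% m <= m)%N by exact: ltnW (ltn_pmod w m_gt0).
by rewrite modnDmr -(modnDml w) addnCA subnKC // modnDr modn_small.
Qed.

(** Toggling by the digits of [v] itself clears the digits [i] and [j], so the successive flips
    climb through the layers. The third flip climbs as well when [c] clears digit [k]. *)
Lemma corner_chain i j k v c : i != j -> i != k -> j != k ->
  exists a b, let u := corner i j k v a b c in
    [/\ weight (flip i u) = (weight u).+1,
        weight (flip j (flip i u)) = (weight u).+2 &
        c = digit k v -> weight (flip k (flip j (flip i u))) = (weight u).+3].
Proof.
move=> ij ik jk; exists (digit i v), (digit j v) => u.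
have [ui uj uk] : [/\ ~~ digit i u, ~~ digit j u &
    c = digit k v -> ~~ digit k u].
  rewrite /u !digit_corner !eqxx (eq_sym j i) (eq_sym k i) (eq_sym k j).
  rewrite (negbTE ij) (negbTE ik) (negbTE jk) !andbF !andbT !addbF !addbb.
  by split=> // ->; rewrite addbb.
have uj' : ~~ digit j (flip i u) by rewrite digit_flip eq_sym (negbTE ij) addbF.
split; [by rewrite weight_flip|by rewrite !weight_flip|move=> /uk uk'].
have uk'' : ~~ digit k (flip j (flip i u)).
  by rewrite !digit_flip !(eq_sym k) (negbTE ik) (negbTE jk) !addbF.
by rewrite !weight_flip.
Qed.

End Layers.

Lemma cube3_of_digits (a b c : bool) : exists s : hypercube 3,
  [/\ digit 0 s = a, digit 1 s = b & digit 2 s = c].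
Proof.
have [s sE] := @vertex_of_digits 3 (fun i : 'I_3 => nth c [:: a; b] i).
exists s; split; [exact: (sE (@Ordinal 3 0 isT))|exact: (sE (@Ordinal 3 1
  isT))|].
exact: (sE (@Ordinal 3 2 isT)).
Qed.

(** The corners with third bit [false] avoid vertex 7 and contain a path through three consecutive
    layers, one of which is deleted. *)
Lemma off_layers3_free n r : (r < 3)%N ->
  graph_free (fun F => F = R2) (induced (off_layers n 3 r)).
Proof.
move=> lt_r; apply/free_R2_B3m/cc_freeP => _ -> /(cube3_redP _ [:: 7%N])[g].
move=> [g_inj g_edge gS].
have [||i [j [k [ij ik jk gE]]]] := @embedding_frame n g.
- by move=> s t _ _; apply: g_inj.
- by move=> s t _ _; apply: g_edge.
have cS a b : corner i j k (g (vtx 0)) a b false \in off_layers n 3 r.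
  have [s [sa sb sc]] := cube3_of_digits a b false.
  have s7 : (s : nat) != 7 by apply: contraFneq sc => ->.
  by rewrite -sa -sb -sc -[corner _ _ _ _ _ _ _]/(cube_map i j k _ s) -gE //
    gS ?inE.
have [a [b /= [u1 u2 _]]] := corner_chain (g (vtx 0)) false ij ik jk.
move: (cS a b) (cS (~~ a) b) (cS (~~ a) (~~ b)).
have [E1 _ _] := flip_corner i j k (g (vtx 0)) a b false.
have [_ E2 _] := flip_corner i j k (g (vtx 0)) (~~ a) b false.
rewrite -E2 -E1 !inE u1 u2.
have [t lt_t <-] := residue_hit (weight (corner i j k (g (vtx 0)) a b false))
  lt_r.
by case: t lt_t => [|[|[|]]] // _; rewrite ?addn0 ?addn1 ?addn2 eqxx ?andbF.
Qed.

Lemma off_layers4_free n r : (r < 4)%N ->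
  graph_free (fun F => F = hypercube 3) (induced (off_layers n 4 r)).
Proof.
move=> lt_r; apply/free_Q3_B3/cc_freeP => _ -> /(cube3_redP _ [::])[g].
move=> [g_inj g_edge gS].
have [||i [j [k [ij ik jk gE]]]] := @embedding_frame n g.
- by move=> s t _ _; apply: g_inj.
- by move=> s t _ _; apply: g_edge.
set v := g (vtx 0) in gE.
(* The frame leaves out vertex 7. Its image is the common neighbour, other than the image of 1, of
   the images of 3 and 5. *)
have g7 : g (vtx 7) = cube_map i j k v (vtx 7).
  have g1 : g (vtx 1) = flip i v by rewrite gE.
  have g3 : g (vtx 3) = flip j (g (vtx 1)) by rewrite g1 gE // flipC.
  have g5 : g (vtx 5) = flip k (g (vtx 1)) by rewrite g1 gE // flipC.
  have [/g_inj //|->] : g (vtx 7) = g (vtx 1) \/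
      g (vtx 7) = flip k (flip j (g (vtx 1))).
    by apply: common_neighbour => //; rewrite -?g3 -?g5; apply: g_edge;
      rewrite edge3E.
  by rewrite g1 [RHS]/(flip i (flip j (flip k v))); flips.
have cS a b c : corner i j k v a b c \in off_layers n 4 r.
  have [s [sa sb sc]] := cube3_of_digits a b c.
  rewrite -sa -sb -sc -[corner _ _ _ _ _ _ _]/(cube_map i j k _ s).
  have [s7|s7] := eqVneq (s : nat) 7; last by rewrite -gE // gS.
  by rewrite (_ : s = vtx 7) -?g7 ?gS //; apply: val_inj.
have [a [b /= [u1 u2 /(_ erefl) u3]]] := corner_chain v (digit k v) ij ik jk.
set c := digit k v in u1 u2 u3.
move: (cS a b c) (cS (~~ a) b c) (cS (~~ a) (~~ b) c) (cS (~~ a) (~~ b) (~~ c)).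
have [E1 _ _] := flip_corner i j k v a b c.
have [_ E2 _] := flip_corner i j k v (~~ a) b c.
have [_ _ E3] := flip_corner i j k v (~~ a) (~~ b) c.
rewrite -E3 -E2 -E1 !inE u1 u2 u3.
have [t lt_t <-] := residue_hit (weight (corner i j k v a b c)) lt_r.
by case: t lt_t => [|[|[|[|]]]] // _; rewrite ?addn0 ?addn1 ?addn2 ?addn3 eqxx.
Qed.

(** The ends of an edge have weights of opposite parity, so no edge survives. *)
Lemma off_layers2_free n r : (r < 2)%N ->
  graph_free (fun F => F = C6) (induced (off_layers n 2 r)).
Proof.
move=> lt_r; apply/graph_free_inducedP => _ -> [f [f_inj f_edge fS]].
have /edge_flipP[i f1] : edge (f (@Ordinal 6 0 isT)) (f (@Ordinal 6 1 isT)).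
  exact: f_edge.
move: (fS (@Ordinal 6 0 isT)) (fS (@Ordinal 6 1 isT)).
rewrite f1 !inE !modn2 odd_weight_flip.
by clear fS; case: r lt_r => [|[|r]] // _; case: (odd _).
Qed.

Lemma vertex_turan_density_ge (R : realType) (Fs : sgraph -> Prop) m :
  (forall n r, (r < m.+1)%N -> graph_free Fs (induced (off_layers n m.+1 r))) ->
  m%:R / m.+1%:R <= vertex_turan_density R Fs.
Proof.
move=> Fs_free; apply: limr_ge; first exact: vertex_turan_density_cvg.
apply: nearW => n; have [r lt_r rP] := @off_layers_dense n m.+1 isT.
apply: (@le_trans _ _ (#|induced (off_layers n m.+1 r)|%:R / #|hypercube
  n|%:R)).
  rewrite card_sig card_ord ler_pdivrMr ?ltr0n // mulrAC.
  rewrite ler_pdivlMr ?ltr0n ?expn_gt0 // -!natrM ler_nat mulnC [leqRHS]mulnC.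
  by rewrite mulnC; apply: leq_trans rP _; rewrite leq_mul2l /= subset_leq_card.
apply: (le_bigmax_cond 0
  (fun S : {set hypercube n} => #|induced S|%:R / #|hypercube n|%:R)).
by apply/asboolP; apply: Fs_free.
Qed.

(** * Certificates for colourings of the 4-cube *)

Definition face := bool -> bool -> bool.
Definition cube3 := bool -> bool -> bool -> bool.
Definition cube4 := bool -> bool -> bool -> bool -> bool.

(** Plain recursion over binary integers, so that the certificates can be checked by evaluation;
    [zsumE] leads back to big sums. *)
Definition zsum (A : Type) (s : seq A) (f : A -> Z) : Z :=
  foldr (fun a z => Z.add (f a) z) Z0 s.
Definition bsum (f : bool -> Z) : Z := Z.add (f false) (f true).

Lemma zsumE A (s : seq A) f : zsum s f = \sum_(a <- s) f a.
Proof. by elim: s => [|a s IH]; rewrite ?big_nil // big_cons -IH. Qed.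

(* The pairs (w, u) of a certificate stand for the positive semidefinite matrix
   with entries \sum_(w, u) w * u_x * u_y. *)
Definition certificate := seq (Z * seq Z).

Definition quadratic (cert : certificate) (x y : nat) : Z :=
  zsum cert (fun q => Z.mul q.1 (Z.mul (nth Z0 q.2 x) (nth Z0 q.2 y))).

Definition nonneg_cert (cert : certificate) : bool :=
  all (fun q => Z.leb Z0 q.1) cert.

Definition face_code (x : face) : nat :=
  x false false + (x true false).*2 + (x false true).*2.*2
  + (x true true).*2.*2.*2.

(* The colouring of a square around a vertex, up to exchanging the neighbours. *)
Definition flag_code (b c bc : bool) : nat := b + c + bc * 3.

Definition face_term (cert : seq (nat * certificate)) (t x y : face) : Z :=
  zsum cert (fun p => if p.1 == face_code t
                      then quadratic p.2 (face_code x) (face_code y) else Z0).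

(** The eight symmetries of the square: [p] and [q] reflect, [s] exchanges the directions. *)
Definition relabel (p q s : bool) (x : face) : face :=
  fun a b => x ((if s then b else a) (+) p) ((if s then a else b) (+) q).

Definition face_sum (cert : seq (nat * certificate)) (t x y : face) : Z :=
  bsum (fun p => bsum (fun q => bsum (fun s =>
    face_term cert (relabel p q s t) (relabel p q s x) (relabel p q s y)))).

(** Functions of booleans are stored as nested pairs, so that each value of a form is computed once
    and then looked up for all colourings of the 4-cube. *)
Definition tab (A : Type) (f : bool -> A) : A * A := (f false, f true).
Definition get (A : Type) (p : A * A) (b : bool) : A := if b then p.2 else p.1.

Lemma get_tab A (f : bool -> A) b : get (tab f) b = f b.
Proof. by case: b. Qed.

Definition mkface (p q r s : bool) : face :=
  fun a b => if b then (if a then s else r) else (if a then q else p).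

Lemma mkfaceK (x : face) :
  mkface (x false false) (x true false) (x false true) (x true true) = x.
Proof. by apply/funext => -[]; apply/funext => -[]. Qed.

Definition tab4 (A : Type) (f : face -> A) :=
  tab (fun p => tab (fun q => tab (fun r => tab (fun s => f (mkface p q r
    s))))).
Definition get4 (A : Type) (t : A * A * (A * A) * (A * A * (A * A))
                              * (A * A * (A * A) * (A * A * (A * A))))
    (x : face) : A :=
  get (get (get (get t (x false false)) (x true false)) (x false true))
    (x true true).

Lemma get4_tab4 A (f : face -> A) x : get4 (tab4 f) x = f x.
Proof. by rewrite /get4 !get_tab mkfaceK. Qed.

Definition face_table cert :=
  tab4 (fun t => tab4 (fun x => tab4 (fun y => face_sum cert t x y))).
Definition red_table (cert : certificate) :=
  tab (fun i => tab (fun j => tab (fun ij =>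
  tab (fun k => tab (fun l => tab (fun kl =>
    quadratic cert (flag_code i j ij) (flag_code k l kl))))))).

Definition shift (p q s t : bool) (x : cube4) : cube4 :=
  fun a b e d => x (a (+) p) (b (+) q) (e (+) s) (d (+) t).

Definition over_shifts (g : cube4 -> Z) (x : cube4) : Z :=
  bsum (fun p => bsum (fun q => bsum (fun s => bsum (fun t =>
    g (shift p q s t x))))).

(** The three ways to split four directions into two pairs; [over_pairs] also orders the two
    pairs. *)
Definition over_pairings (g : cube4 -> Z) (x : cube4) : Z :=
  Z.add (g x) (Z.add (g (fun a b e d => x a e b d))
                     (g (fun a b e d => x a e d b))).

Definition over_pairs (g : cube4 -> Z) (x : cube4) : Z :=
  Z.add (over_pairings g x)
        (over_pairings (fun y => g (fun a b e d => y e d a b)) x).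

Definition face_value T (x : cube4) : Z :=
  bsum (fun e => bsum (fun d =>
    get4 (get4 (get4 T (fun a b => x a b e d)) (fun a b => x a b (~~ e) d))
      (fun a b => x a b e (~~ d)))).

Definition red_value T (x : cube4) : Z :=
  if x false false false false then Z0 else
  get (get (get (get (get (get T (x true false false false))
    (x false true false false)) (x true true false false))
    (x false false true false)) (x false false false true))
    (x false false true true).

Definition blue_value (x : cube4) : Z :=
  if x false false false false then Z.pos xH else Z0.

(* A 4-cube has 16 vertices, 192 labelled faces and 48 pairs of opposite squares
   around a vertex; with the coefficient 6 the first term averages to 96 D times
   the density, so that a check against K proves the bound K / (96 D). *)
Definition cube_value (D : Z) T2 T0 (x : cube4) : Z :=
  Z.add (Z.mul (Z.mul 6 D) (over_shifts blue_value x))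
    (Z.add (over_pairs (face_value T2) x) (over_pairings (over_shifts
      (red_value T0)) x)).

(** * Invariance under translations of the 4-cube *)

Definition shift_invariant (g : cube4 -> Z) : Prop :=
  forall p q s t x, g (shift p q s t x) = g x.

Lemma bsum_shift (F : bool -> Z) p : bsum (fun a => F (p (+) a)) = bsum F.
Proof. by case: p => //; apply: Z.add_comm. Qed.

Lemma eq_bsum (F G : bool -> Z) : (forall b, F b = G b) -> bsum F = bsum G.
Proof. by move=> FG; rewrite /bsum !FG. Qed.

Lemma shift_shift p q s t p' q' s' t' x :
  shift p q s t (shift p' q' s' t' x) =
  shift (p' (+) p) (q' (+) q) (s' (+) s) (t' (+) t) x.
Proof.
do 4![apply/funext => ?]; rewrite /shift -!addbA.
by rewrite (addbC p) (addbC q) (addbC s) (addbC t).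
Qed.

Lemma over_shifts_invariant g : shift_invariant (over_shifts g).
Proof.
move=> p q s t x; rewrite -[RHS](bsum_shift _ p); apply: eq_bsum => p'.
rewrite -[RHS](bsum_shift _ q); apply: eq_bsum => q'.
rewrite -[RHS](bsum_shift _ s); apply: eq_bsum => s'.
rewrite -[RHS](bsum_shift _ t); apply: eq_bsum => t'.
by rewrite shift_shift.
Qed.

Lemma over_pairings_invariant g :
  shift_invariant g -> shift_invariant (over_pairings g).
Proof.
move=> gP p q s t x; congr (Z.add _ (Z.add _ _)); first exact: gP.
  exact: (gP p s q t (fun a b e d => x a e b d)).
exact: (gP p t q s (fun a b e d => x a e d b)).
Qed.

Lemma over_pairs_invariant g :
  shift_invariant g -> shift_invariant (over_pairs g).
Proof.
move=> gP p q s t x; congr Z.add; first exact: over_pairings_invariant.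
apply: over_pairings_invariant => {}p {}q {}s {}t {}x.
exact: (gP s t p q (fun a b e d => x e d a b)).
Qed.

Lemma face_sum_relabel cert t x y p q :
  face_sum cert (relabel p q false t) (relabel p q false x)
    (relabel p q false y) = face_sum cert t x y.
Proof.
have relabelK p' q' s z : relabel p' q' s (relabel p q false z) =
    relabel (p (+) p') (q (+) q') s z.
  do 2![apply/funext => ?]; rewrite /relabel -!addbA.
  by rewrite (addbC p') (addbC q').
rewrite -[RHS](bsum_shift _ p); apply: eq_bsum => p'.
rewrite -[RHS](bsum_shift _ q); apply: eq_bsum => q'.
by apply: eq_bsum => s; rewrite !relabelK.
Qed.

Lemma face_valueE cert x : face_value (face_table cert) x =
  bsum (fun e => bsum (fun d => face_sum cert (fun a b => x a b e d)
    (fun a b => x a b (~~ e) d) (fun a b => x a b e (~~ d)))).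
Proof.
by apply: eq_bsum => e; apply: eq_bsum => d; rewrite /face_table !get4_tab4.
Qed.

Lemma face_value_invariant cert :
  shift_invariant (face_value (face_table cert)).
Proof.
move=> p q s t x; rewrite !face_valueE.
rewrite -[RHS](bsum_shift _ s); apply: eq_bsum => e.
rewrite -[RHS](bsum_shift _ t); apply: eq_bsum => d.
rewrite (addbC s) (addbC t) -!addNb.
by rewrite -[RHS](face_sum_relabel cert _ _ _ p q).
Qed.

Lemma cube_value_invariant D cert2 T0 :
  shift_invariant (cube_value D (face_table cert2) T0).
Proof.
move=> p q s t x; congr (Z.add (Z.mul _ _) (Z.add _ _)).
- exact: over_shifts_invariant.
- exact/over_pairs_invariant/face_value_invariant.
- exact/over_pairings_invariant/over_shifts_invariant.
Qed.

(** * Enumeration of the admissible colourings of the 4-cube *)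

Definition allb (P : bool -> bool) : bool := if P false then P true else false.
Definition all_faces (P : face -> bool) : bool :=
  allb (fun p => allb (fun q => allb (fun r => allb (fun s =>
    P (mkface p q r s))))).

Lemma allbP (P : bool -> bool) : allb P -> forall b, P b.
Proof. by rewrite /allb; case: ifP => // Pf Pt []. Qed.

Lemma allbI (P : bool -> bool) : (forall b, P b) -> allb P.
Proof. by move=> Pb; rewrite /allb !Pb. Qed.

Lemma all_facesP (P : face -> bool) : all_faces P -> forall x, P x.
Proof.
move=> H x; rewrite -(mkfaceK x).
exact: (allbP (allbP (allbP (allbP H _) _) _) _).
Qed.

Definition stack (x y : face) : cube3 := fun a b c => if c then y a b else x a
  b.

Definition stack4 (x00 x10 x01 x11 : face) : cube4 :=
  fun a b e d => if d then (if e then x11 a b else x01 a b)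
                 else (if e then x10 a b else x00 a b).

Definition facets_ok (ok : cube3 -> bool) (x : cube4) : bool :=
  [&& allb (fun d => ok (fun a b e => x a b e d)),
      allb (fun e => ok (fun a b d => x a b e d)),
      allb (fun b => ok (fun a e d => x a b e d)) &
      allb (fun a => ok (fun b e d => x a b e d))].

Definition shift3 (p q s : bool) (y : cube3) : cube3 :=
  fun a b e => y (a (+) p) (b (+) q) (e (+) s).

Definition cube_code (y : cube3) : nat :=
  face_code (fun a b => y a b false) * 16 + face_code (fun a b => y a b true).

(* Shifts act on the colourings of a facet; only one colouring of each orbit
   has to be considered. *)
Definition minimal (y : cube3) : bool :=
  allb (fun p => allb (fun q => allb (fun s =>
    cube_code y <= cube_code (shift3 p q s y))))%N.

Definition tabulate (ok : cube3 -> bool) :=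
  tab4 (fun x => tab4 (fun y => ok (stack x y))).
Definition lookup T (x y : face) : bool := get4 (get4 T x) y.

Lemma lookupE (ok : cube3 -> bool) (y : cube3) :
  lookup (tabulate ok) (fun a b => y a b false) (fun a b => y a b true) = ok y.
Proof.
rewrite /lookup !get4_tab4; congr ok; rewrite /stack.
by apply/funext => a; apply/funext => b; apply/funext => -[].
Qed.

(** Colourings are assembled from four parallel faces and dropped once a facet fails. Conditionals
    replace [&&], whose arguments would both be evaluated under call by value. *)
Definition all_cubes (ok : cube3 -> bool) (P : cube4 -> bool) : bool :=
  let T := tabulate ok in
  let Tmin := tabulate (fun y => ok y && minimal y) in
  all_faces (fun x00 => all_faces (fun x10 =>
  if lookup Tmin x00 x10 then all_faces (fun x01 =>
  if lookup T x00 x01 then all_faces (fun x11 =>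
  if lookup T x10 x11 then if lookup T x01 x11 then
    let x := stack4 x00 x10 x01 x11 in
    if allb (fun b => lookup T (fun a e => x a b e false) (fun a e => x a b e
      true))
    then if allb (fun a =>
      lookup T (fun b e => x a b e false) (fun b e => x a b e true))
    then P x else true else true else true else true) else true) else true)).

Lemma all_cubesP ok P : all_cubes ok P ->
  forall x, facets_ok ok x -> minimal (fun a b e => x a b e false) -> P x.
Proof.
move=> H x /and4P[/allbP okd /allbP oke /allbP okb /allbP oka] x_min.
have xE : x = stack4 (fun a b => x a b false false) (fun a b => x a b true
  false)
    (fun a b => x a b false true) (fun a b => x a b true true).
  by do 2![apply/funext => ?]; apply/funext => -[]; apply/funext => -[].
have {H} := all_facesP (all_facesP H (fun a b => x a b false false))
  (fun a b => x a b true false).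
rewrite (lookupE _ (fun a b e => x a b e false)) okd x_min => /all_facesP.
move=> /(_ (fun a b => x a b false true)).
rewrite (lookupE _ (fun a b d => x a b false d)) oke => /all_facesP.
move=> /(_ (fun a b => x a b true true)).
rewrite (lookupE _ (fun a b d => x a b true d)) oke.
rewrite (lookupE _ (fun a b e => x a b e true)) okd; cbv beta zeta; rewrite -xE.
have -> : allb (fun b => lookup (tabulate ok) (fun a e => x a b e false)
    (fun a e => x a b e true)).
  by rewrite /allb !(lookupE _ (fun a e d => x a _ e d)) !okb.
have -> // : allb (fun a => lookup (tabulate ok) (fun b e => x a b e false)
    (fun b e => x a b e true)).
by rewrite /allb !(lookupE _ (fun b e d => x _ b e d)) !oka.
Qed.

Definition shift3_invariant (ok : cube3 -> bool) : Prop :=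
  forall p q s y, ok (shift3 p q s y) = ok y.

Lemma allb_shift (P : bool -> bool) p : allb (fun a => P (a (+) p)) = allb P.
Proof. by case: p; rewrite /allb /=; case: (P false); case: (P true). Qed.

Lemma facets_ok_shift ok p q s t x : shift3_invariant ok ->
  facets_ok ok (shift p q s t x) = facets_ok ok x.
Proof.
move=> okP; congr [&& _, _, _ & _].
- rewrite -[RHS](allb_shift _ t); congr allb; apply/funext => d.
  exact: (okP p q s (fun a b e => x a b e (d (+) t))).
- rewrite -[RHS](allb_shift _ s); congr allb; apply/funext => e.
  exact: (okP p q t (fun a b d => x a b (e (+) s) d)).
- rewrite -[RHS](allb_shift _ q); congr allb; apply/funext => b.
  exact: (okP p s t (fun a e d => x a (b (+) q) e d)).
- rewrite -[RHS](allb_shift _ p); congr allb; apply/funext => a.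
  exact: (okP q s t (fun b e d => x (a (+) p) b e d)).
Qed.

Lemma minimal_shift (y : cube3) : exists p q s, minimal (shift3 p q s y).
Proof.
pose code (r : bool * bool * bool) := cube_code (shift3 r.1.1 r.1.2 r.2 y).
have [[[p q] s] _ min_r] := arg_minnP code (isT : xpredT (false, false, false)).
exists p, q, s.
have E p' q' s' : shift3 p' q' s' (shift3 p q s y) =
    shift3 (p' (+) p) (q' (+) q) (s' (+) s) y.
  by do 3![apply/funext => ?]; rewrite /shift3 -!addbA.
apply: allbI => p'; apply: allbI => q'; apply: allbI => s'; rewrite E.
exact: (min_r (p' (+) p, q' (+) q, s' (+) s)).
Qed.

Definition check_cubes ok cert2 cert0 (D K : Z) : bool :=
  let T2 := face_table cert2 in let T0 := red_table cert0 in
  [&& all (fun p => nonneg_cert p.2) cert2, nonneg_cert cert0 &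
      all_cubes ok (fun x => Z.leb (cube_value D T2 T0 x) K)].

(** Some translation makes the enumerated facet minimal, and it changes neither the value nor the
    admissibility of the colouring. *)
Lemma check_cubesP ok cert2 cert0 D K : shift3_invariant ok ->
  check_cubes ok cert2 cert0 D K ->
  [/\ all (fun p => nonneg_cert p.2) cert2, nonneg_cert cert0 &
    forall x, facets_ok ok x ->
      cube_value D (face_table cert2) (red_table cert0) x <= K].
Proof.
move=> okP /and3P[cert2P cert0P /all_cubesP H]; split=> // x x_ok.
have [p [q [s min_y]]] := minimal_shift (fun a b e => x a b e false).
rewrite -(cube_value_invariant _ _ _ p q s false).
by apply: H; rewrite ?facets_ok_shift.
Qed.

(** * Forbidden patterns and the numerical certificates *)

Definition blue_off (r : seq nat) (y : cube3) : bool :=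
  all (fun s => (s \in r) || y (digit 0 s) (digit 1 s) (digit 2 s)) (iota 0 8).

(** Translates cover all copies of the pattern in the 3-cube for the sets [r] used below, which are
    invariant under permutations of the coordinates. *)
Definition avoids (r : seq nat) (y : cube3) : bool :=
  allb (fun p => allb (fun q => allb (fun t =>
    ~~ blue_off r (fun a b c => y (a (+) p) (b (+) q) (c (+) t))))).

Definition blue_face (x : face) : bool :=
  [&& x false false, x true false, x false true & x true true].

Definition no_blue_face (y : cube3) : bool :=
  [&& allb (fun c => ~~ blue_face (fun a b => y a b c)),
      allb (fun b => ~~ blue_face (fun a c => y a b c)) &
      allb (fun a => ~~ blue_face (fun b c => y a b c))].

(* A face certificate is indexed by the code of the labelled face; only one
   labelling of each colouring is listed, as [face_sum] runs over all of them.
   The forms for R2 are exact at the colourings that attain 2/3. *)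
Section Certificates.
Local Open Scope Z_scope.

Definition R2_faces : seq (nat * certificate) := [::
  (3%N, [::
    (273, [:: 0; 0; 0; -19; 0; 2; 3; -10; 0; 3; 2; -10; 20; 0; 0; -20]);
    (672, [:: 0; -2; 2; 0; 0; -1; 12; 10; 0; -12; 1; -10; 0; 15; -15; 0])]);
  (7%N, [::
    (600, [:: 0; 5; 1; -6; 1; -6; 53; -14; 4; 0; 12; -12; 12; -12; 0; 0]);
    (4792, [:: 0; 0; 1; 10; -1; -10; 0; 0; 0; 0; 10; 10; -10; -10; 0; 0])]);
  (15%N, [::
    (1400, [:: 0; 1; -1; 0; -1; 0; 10; 0; 1; -10; 0; 0; 0; 0; 0; 0]);
    (102900, [:: 0; 0; 0; 1; 0; 0; 0; 0; 0; 0; 0; 0; -1; 0; 0; 0]);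
    (102900, [:: 0; 0; 0; 0; 0; 1; 0; 0; 0; 0; -1; 0; 0; 0; 0; 0])])].
Definition R2_red : certificate := [::
  (140, [:: 5; 7; -20; -13; 48; 20])].

Definition Q3_faces : seq (nat * certificate) := [::
  (7%N, [::
    (1, [:: 0; -1384; 0; -349; 0; -349; -349; 0; 0; 1782; -349; -13631; -349;
            43312; -19532; 5253]);
    (1, [:: 0; -1917; 0; -483; 0; -483; -483; 0; 0; 2467; -483; 41103; -483; 0;
            -27048; 7274]);
    (1, [:: 0; -4345; 0; -1094; 0; -1094; -1094; 0; 0; -12866; -1094; 0; -1094;
            0; -10438; 16488])]);
  (15%N, [::
    (1, [:: 0; 243; 243; 0; 243; 0; 21778; -3666; 243; 21778; 0; -3663; 0;
            -3664; -3661; 0]);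
    (1, [:: 0; 0; 1059; 0; -1059; 0; 0; 2; 0; 0; 0; -15957; 0; 15957; -2; 0]);
    (1, [:: 0; 1058; 0; 0; 0; 0; 0; -15954; -1058; 0; 0; 0; 0; 0; 15954; 0])])].
Definition Q3_red : certificate := [::
  (1, [:: 0; 2612; 31905; -496; 986; -15840])].

Definition C6_faces : seq (nat * certificate) := [::
  (0%N, [::
    (1, [:: -933; -13548; -13547; 29878; 13307; 60; 424; -21038; 13308; 424;
            58; -21037; -29760; 21015; 21016; 0]);
    (1, [:: -931; 13334; -13521; 0; 13281; -29760; 423; 21057; -13574; 423;
            29878; -20996; 118; 20974; -21079; 0]);
    (1, [:: 20934; 2694; 1500; 0; 3887; -2651; -9520; 243; 2694; -9520; 0;
            -1627; -2651; 2113; 243; 0])]);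
  (1%N, [::
    (1, [:: 3639; 16475; -5934; -17607; -5929; -17647; -22607; 184596; 74;
            -40980; 11230; -47829; 11227; -47837; -8033; 0]);
    (1, [:: -749; 36285; -18559; 149673; -10558; -75753; -12836; 0; 8791;
            -3561; 9198; 9324; -1945; -26456; 1607; 0]);
    (1, [:: -1314; 63365; -23140; 0; -27718; 129075; -22410; 0; 15338; -6185;
            3152; -25187; 9531; -4702; 2799; 0]);
    (1, [:: -23656; 24526; -26450; 0; -26455; 0; 11069; 0; -44583; 110674;
            32890; 43371; 32891; 43374; -25754; 0]);
    (1, [:: 0; 0; 31009; 0; -31009; 0; 0; 0; 0; 0; -6664; -21397; 6664; 21397;
            0; 0])]);
  (3%N, [::
    (1, [:: 12133; -21225; 37309; 0; -6954; -26304; -4190; 0; 47003; -30040;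
            24745; 0; -5139; 91909; -47193; 0]);
    (1, [:: 18530; 6913; -19957; 0; 89462; 2874; -20066; 0; -35840; -8120; -17;
            0; -8117; 0; 44402; 0]);
    (1, [:: -8605; 79449; 689; 0; 0; 25101; -13289; 0; -10043; -21076; -36744;
            0; 4298; 0; 26438; 0]);
    (1, [:: -12509; 0; 70938; 0; 0; -34240; -18783; 0; -23737; -1989; 23659; 0;
            5923; 0; 9494; 0]);
    (1, [:: 20579; 0; 0; 0; 0; 9596; -25977; 0; 62456; -14605; -8440; 0; -8911;
            0; 58514; 0])]);
  (6%N, [::
    (1, [:: 19095; 13361; -45916; 1029; 11620; -26624; 3025; -20935; 13318;
            -183; 1140; -38773; -26484; 77173; -20911; 0]);
    (1, [:: 32941; 23006; -13146; -29863; -46018; -14017; 5218; -36091; 23019;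
            -315; -29865; 66244; -14129; 0; -36098; 0]);
    (1, [:: 0; -3429; 0; 58203; 0; 404; 0; 2349; 3429; 0; -58203; 0; -404; 0;
            -2349; 0]);
    (1, [:: 0; -3395; 0; 0; 0; 58037; 0; 2326; 3395; 0; 0; 0; -58037; 0; -2326;
            0]);
    (1, [:: 0; -26528; 0; 0; 0; 0; 0; 13283; 26528; 0; 0; 0; 0; 0; -13283;
      0])]);
  (7%N, [::
    (1, [:: 85425; -30893; 1965; 0; 1965; 0; -4737; 0; 7283; 1010; -2009; 0;
            -2009; 0; 0; 0])])].
Definition C6_red : certificate := [::
  (1, [:: -17221; 7955; -15503; -16807; -1292; 94461])].

End Certificates.

(** The constants give K / (96 D) = 2/3 here, and 0.769 and 0.53111 in the two checks that
    follow. *)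
Lemma R2_check :
  check_cubes (avoids [:: 7%N]) R2_faces R2_red 252000 16128000.
Proof. by vm_cast_no_check (erefl true). Qed.

Lemma Q3_check :
  check_cubes (avoids [::]) Q3_faces Q3_red 1296000000 95675904000.
Proof. by vm_cast_no_check (erefl true). Qed.

(** Copies of [B4] are excluded through [no_blue_face], since they contain a blue square. *)
Lemma C6_check :
  check_cubes (fun y => avoids [:: 0; 7]%N y && no_blue_face y)
    C6_faces C6_red 1936000000 98709980160.
Proof. by vm_cast_no_check (erefl true). Qed.

(** * Sums over all 4-cubes *)

Section Totals.
Variables (n : nat) (c : hypercube n -> bool).
Implicit Types (i j k l : 'I_n) (v : hypercube n) (f g : cube4 -> Z).

Definition local i j k l v : cube4 :=
  fun a b e d => c (toggle a i (toggle b j (toggle e k (toggle d l v)))).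

Definition total f : Z :=
  \sum_i \sum_j \sum_k \sum_l \sum_v f (local i j k l v).

Lemma eq_total f g : (forall x, f x = g x) -> total f = total g.
Proof. by move=> fg; congr total; apply/funext. Qed.

Lemma totalD f g : total (fun x => f x + g x) = total f + total g.
Proof.
rewrite -big_split /=; apply: eq_bigr => i _.
rewrite -big_split /=; apply: eq_bigr => j _.
rewrite -big_split /=; apply: eq_bigr => k _.
rewrite -big_split /=; apply: eq_bigr => l _.
by rewrite -big_split.
Qed.

Lemma totalM (z : Z) f : total (fun x => z * f x) = z * total f.
Proof.
rewrite mulr_sumr; apply: eq_bigr => i _.
rewrite mulr_sumr; apply: eq_bigr => j _.
rewrite mulr_sumr; apply: eq_bigr => k _.
rewrite mulr_sumr; apply: eq_bigr => l _.
by rewrite mulr_sumr.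
Qed.

Lemma ler_total f g : (forall x, f x <= g x) -> total f <= total g.
Proof.
by move=> fg; do 5![apply: ler_sum => ? _].
Qed.

Lemma total_const (z : Z) :
  total (fun=> z) = (n ^ 4 * 2 ^ n)%:R * z.
Proof.
rewrite /total !(sumr_const, card_ord) -!mulrnA mulr_natl; congr (_ *+ _).
by rewrite mulnC !expnSr expn0 mul1n !mulnA.
Qed.

Definition preserves_total (m : cube4 -> cube4) : Prop :=
  forall f, total (f \o m) = total f.

Lemma preserves_total_comp m1 m2 :
  preserves_total m1 -> preserves_total m2 -> preserves_total (m1 \o m2).
Proof. by move=> H1 H2 f; rewrite -[RHS]H1 -[RHS]H2. Qed.

(** A shift moves the base vertex by an involution of the cube, which reindexes the sum over [v]. *)
Lemma shift_total p q s t : preserves_total (shift p q s t).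
Proof.
move=> f; apply: eq_bigr => i _; apply: eq_bigr => j _; apply: eq_bigr => k _.
apply: eq_bigr => l _.
pose h v := toggle p i (toggle q j (toggle s k (toggle t l v))).
have hK : involutive h.
  by move=> v; apply: vertex_ext => x; rewrite /h !digit_toggle;
    do 4!case: (_ && _); case: (digit x v).
rewrite [RHS](reindex_inj (inv_inj hK)) /=; apply: eq_bigr => v _.
congr f; do 4![apply/funext => ?]; rewrite /shift /local /h; congr c.
apply: vertex_ext => x; rewrite !digit_toggle !andb_addl.
by do 8!case: (_ && _); case: (digit x v).
Qed.

(** Adjacent transpositions; their compositions give every reordering of the four directions. *)
Definition swap12 (x : cube4) : cube4 := fun a b e d => x b a e d.
Definition swap23 (x : cube4) : cube4 := fun a b e d => x a e b d.
Definition swap34 (x : cube4) : cube4 := fun a b e d => x a b d e.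

Lemma swap12_total : preserves_total swap12.
Proof.
move=> f; rewrite [RHS]/total exchange_big /=.
do 5![apply: eq_bigr => ? _]; congr f; do 4![apply/funext => ?].
by rewrite /swap12 /local toggleC.
Qed.

Lemma swap23_total : preserves_total swap23.
Proof.
move=> f; apply: eq_bigr => i _; rewrite [RHS]exchange_big /=.
do 4![apply: eq_bigr => ? _]; congr f; do 4![apply/funext => ?].
by rewrite /swap23 /local; congr (c (toggle _ _ _)); rewrite toggleC.
Qed.

Lemma swap34_total : preserves_total swap34.
Proof.
move=> f; apply: eq_bigr => i _; apply: eq_bigr => j _.
rewrite [RHS]exchange_big /=.
do 3![apply: eq_bigr => ? _]; congr f; do 4![apply/funext => ?].
by rewrite /swap34 /local; congr (c (toggle _ _ (toggle _ _ _)));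
  rewrite toggleC.
Qed.

Definition nonneg_total f : Prop := 0 <= total f.

Lemma nonneg_totalD f g :
  nonneg_total f -> nonneg_total g -> nonneg_total (fun x => Z.add (f x) (g x)).
Proof. by move=> Hf Hg; rewrite /nonneg_total [total _]totalD addr_ge0. Qed.

Lemma nonneg_total_bsum (F : bool -> cube4 -> Z) :
  (forall b, nonneg_total (F b)) -> nonneg_total (fun x => bsum (F^~ x)).
Proof. by move=> FP; apply: nonneg_totalD. Qed.

Lemma nonneg_total_move (m : cube4 -> cube4) f :
  preserves_total m -> nonneg_total f -> nonneg_total (fun x => f (m x)).
Proof. by move=> mP; rewrite /nonneg_total -(mP f). Qed.

Lemma nonneg_over_pairings f :
  nonneg_total f -> nonneg_total (over_pairings f).
Proof.
move=> fP; apply: nonneg_totalD => //; apply: nonneg_totalD.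
  exact: nonneg_total_move swap23_total fP.
have mP := preserves_total_comp swap23_total swap34_total.
exact: (nonneg_total_move mP fP).
Qed.

Lemma nonneg_over_pairs f : nonneg_total f -> nonneg_total (over_pairs f).
Proof.
move=> fP; apply: nonneg_totalD; first exact: nonneg_over_pairings.
apply: (@nonneg_over_pairings (fun y => f (fun a b e d => y e d a b))).
have mP := preserves_total_comp swap23_total (preserves_total_comp swap34_total
  (preserves_total_comp swap12_total swap23_total)).
exact: (nonneg_total_move mP fP).
Qed.

(** The double sum factors into a combination of squares of sums over [I], with the nonnegative
    weights of the certificate. *)
Lemma quadratic_ge0 (cert : certificate) (I : finType) (u : I -> nat) :
  nonneg_cert cert -> 0 <= \sum_i \sum_j quadratic cert (u i) (u j).
Proof.
move=> /allP certP.
have -> : \sum_i \sum_j quadratic cert (u i) (u j) =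
    \sum_(q <- cert) q.1 * (\sum_i nth Z0 q.2 (u i)) ^+ 2.
  transitivity (\sum_i \sum_j \sum_(q <- cert)
      q.1 * (nth Z0 q.2 (u i) * nth Z0 q.2 (u j))).
    by do 2![apply: eq_bigr => ? _]; apply: zsumE.
  under eq_bigr => i _ do rewrite exchange_big /=.
  rewrite exchange_big /=; apply: eq_bigr => q _.
  rewrite expr2 mulr_suml mulr_sumr; apply: eq_bigr => i _.
  by rewrite mulr_sumr mulr_sumr.
by rewrite big_seq; apply: sumr_ge0 => q /certP q0; rewrite mulr_ge0 ?sqr_ge0.
Qed.

(** For fixed [v], [i], [j] the face selects one form, and [k], [l] run independently, so
    [quadratic_ge0] applies to [base]. The other terms are [base] after a shift and possibly a swap,
    which preserve totals. *)
Lemma nonneg_face_value (cert : seq (nat * certificate)) :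
  all (fun p => nonneg_cert p.2) cert ->
  nonneg_total (face_value (face_table cert)).
Proof.
move=> /allP certP.
pose base x := face_term cert (fun a b => x a b false false)
  (fun a b => x a b true false) (fun a b => x a b false true).
have baseP : nonneg_total base.
  rewrite /nonneg_total /total; apply: sumr_ge0 => i _; apply: sumr_ge0 => j _.
  under eq_bigr => k _ do rewrite exchange_big /=.
  rewrite exchange_big /=; apply: sumr_ge0 => v _.
  have -> : \sum_k \sum_l base (local i j k l v) =
      \sum_(p <- cert) \sum_k \sum_l
        (if p.1 == face_code (fun a b => c (toggle a i (toggle b j v)))
         then quadratic p.2
           (face_code (fun a b => c (toggle a i (toggle b j (flip k v)))))
           (face_code (fun a b => c (toggle a i (toggle b j (flip l v)))))
         else 0).
    rewrite [RHS]exchange_big /=; apply: eq_bigr => k _.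
    rewrite [RHS]exchange_big /=; apply: eq_bigr => l _.
    exact: zsumE.
  rewrite big_seq; apply: sumr_ge0 => p /certP p0.
  case: (p.1 == face_code _) => /=.
    exact: quadratic_ge0.
  by rewrite big1 // => k _; rewrite big1.
rewrite /nonneg_total (eq_total (face_valueE cert)).
apply: (@nonneg_total_bsum (fun e x => bsum (fun d => _))) => e.
apply: (@nonneg_total_bsum (fun d x => _)) => d.
apply: (@nonneg_total_bsum (fun p x => bsum (fun q => bsum (fun s => _)))) => p.
apply: (@nonneg_total_bsum (fun q x => bsum (fun s => _))) => q.
apply: (@nonneg_total_bsum (fun s x => _)) => s.
case: s.
  have mP := preserves_total_comp swap12_total (shift_total p q e d).
  exact: (nonneg_total_move mP baseP).
exact: (nonneg_total_move (shift_total p q e d) baseP).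
Qed.

Lemma nonneg_over_shifts f : nonneg_total f -> nonneg_total (over_shifts f).
Proof.
move=> fP; do 4![apply: nonneg_total_bsum => ?].
exact: (nonneg_total_move (shift_total _ _ _ _) fP).
Qed.

(** At a fixed red [v] the pairs [(i, j)] and [(k, l)] vary independently and give a double sum as
    in [quadratic_ge0]; a blue [v] contributes 0. *)
Lemma nonneg_red_value (cert : certificate) :
  nonneg_cert cert -> nonneg_total (red_value (red_table cert)).
Proof.
move=> certP; rewrite /nonneg_total /total.
under eq_bigr => i _.
  under eq_bigr => j _.
    under eq_bigr => k _ do rewrite exchange_big /=.
    rewrite exchange_big /=; over.
  rewrite exchange_big /=; over.
rewrite exchange_big /=; apply: sumr_ge0 => v _.
have [cv|cv] := boolP (c v).
  rewrite big1 // => i _; rewrite big1 // => j _; rewrite big1 // => k _.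
  by rewrite big1 // => l _; rewrite /red_value /local /= cv.
pose u (p : 'I_n * 'I_n) := flag_code (c (flip p.1 v)) (c (flip p.2 v))
  (c (flip p.1 (flip p.2 v))).
rewrite pair_big /=.
rewrite (eq_bigr (fun p => \sum_q quadratic cert (u p) (u q))).
  exact: quadratic_ge0.
move=> [i j] _; rewrite pair_big /=; apply: eq_bigr => -[k l] _.
by rewrite /red_value /red_table !get_tab /local /= (negbTE cv).
Qed.

Lemma total_blue : total (over_shifts blue_value) =
  (16 * n ^ 4 * #|[set v | c v]|)%:R.
Proof.
have base_total : total blue_value = (n ^ 4 * #|[set v | c v]|)%:R.
  rewrite /total.
  under eq_bigr => i _.
    under eq_bigr => j _.
      under eq_bigr => k _.
        under eq_bigr => l _.
          rewrite /blue_value /local /= -big_mkcond /= sumr_const.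
          have -> : #|c| = #|[set v | c v]| by apply: eq_card => v; rewrite inE.
          over.
        rewrite sumr_const card_ord; over.
      rewrite sumr_const card_ord; over.
    rewrite sumr_const card_ord; over.
  rewrite sumr_const card_ord -!mulrnA; congr (_ *+ _).
  by rewrite mulnC !expnSr expn0 mul1n !mulnA.
have total2 (F : bool -> cube4 -> Z) z : (forall b, total (F b) = z) ->
    total (fun x => bsum (F^~ x)) = z *+ 2.
  by move=> FP; rewrite [LHS]totalD !FP mulr2n.
rewrite (total2 _ (total blue_value *+ 2 *+ 2 *+ 2)).
  rewrite base_total -!mulrnA; congr (_ *+ _).
  by rewrite -[in RHS]mulnA [in RHS]mulnC -!mulnA.
move=> p; apply: (total2 _ _) => q; apply: (total2 _ _) => s;
  apply: (total2 _ _) => t.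
exact: (shift_total p q s t blue_value).
Qed.

End Totals.

(** * The counting bound in a fixed dimension *)

Section Bound.
Variables (n : nat) (c : hypercube n -> bool) (ok : cube3 -> bool).

Definition indicator (b : bool) : Z := if b then Z.pos xH else Z0.

Definition local3 (i j k : 'I_n) (v : hypercube n) : cube3 :=
  fun a b e => c (corner i j k v a b e).

Definition bad_count : Z :=
  \sum_i \sum_j \sum_k \sum_v indicator (~~ ok (local3 i j k v)).

(** A union bound over the eight facets: each is a bad 3-cube for [bad_count] choices, with [n]
    choices of the remaining direction. *)
Lemma total_facets :
  total c (fun x => indicator (~~ facets_ok ok x)) <= (8 * n)%:R * bad_count.
Proof.
pose base (x : cube4) := indicator (~~ ok (fun a b e => x a b e false)).
have baseE : total c base = n%:R * bad_count.
  rewrite /total /bad_count mulr_natl -sumrMnl; apply: eq_bigr => i _.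
  rewrite -sumrMnl; apply: eq_bigr => j _; rewrite -sumrMnl;
    apply: eq_bigr => k _.
  transitivity (\sum_(l < n) \sum_v indicator (~~ ok (local3 i j k v))) => //.
  by rewrite sumr_const card_ord.
have moveE (m : cube4 -> cube4) (d : bool) : preserves_total c m ->
    total c (fun x => indicator (~~ ok (fun a b e => m x a b e d))) =
    n%:R * bad_count.
  move=> mP; rewrite -baseE -[RHS](shift_total c false false false d) -[RHS]mP.
  apply: eq_total => x /=; congr (indicator (~~ ok _)).
  by do 3![apply/funext => ?]; rewrite /shift !addbF.
(* These reorderings bring the third, second and first coordinate into last place, where [moveE]
   fixes it. *)
have m3 := swap34_total c.
have m2 := preserves_total_comp m3 (swap23_total c).
have m1 := preserves_total_comp m2 (swap12_total c).
pose F d x := indicator (~~ ok (fun a b e => x a b e d)) +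
  (indicator (~~ ok (fun a b e => swap34 x a b e d)) +
  (indicator (~~ ok (fun a b e => (swap34 \o swap23) x a b e d)) +
   indicator (~~ ok (fun a b e => ((swap34 \o swap23) \o swap12) x a b e d)))).
have FE d : total c (F d) = n%:R * bad_count *+ 4.
  rewrite /F !totalD (moveE id) // (moveE _ _ m3) (moveE _ _ m2) (moveE _ _ m1).
  by rewrite !mulrS mulr0n addr0.
apply: (@le_trans _ _ (total c (fun x => F false x + F true x))); last first.
  by rewrite totalD !FE -mulrnDr -mulrnAl -mulrnA mulnC.
apply: ler_total => x; rewrite /facets_ok /allb /F /swap12 /swap23 /swap34 /=.
by do 8!case: (ok _).
Qed.

(** The total of [cube_value] is at least its blue part, as the forms add nonnegative totals. Each
    4-cube contributes at most [K], or [K + M] if a facet is bad. *)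
Lemma blue_bound cert2 cert0 (D K M : Z) :
  shift3_invariant ok -> check_cubes ok cert2 cert0 D K -> 0 <= M ->
  (forall x, cube_value D (face_table cert2) (red_table cert0) x <= K + M) ->
  6 * D * (16 * n ^ 4 * #|[set v | c v]|)%:R <=
  (n ^ 4 * 2 ^ n)%:R * K + M * ((8 * n)%:R * bad_count).
Proof.
move=> okP /(check_cubesP okP)[cert2P cert0P checkP] M0 MP.
have lower : 6 * D * (16 * n ^ 4 * #|[set v | c v]|)%:R <=
    total c (cube_value D (face_table cert2) (red_table cert0)).
  rewrite /cube_value [leRHS]totalD [X in _ <= X + _]totalM total_blue lerDl.
  apply: nonneg_totalD.
    exact/nonneg_over_pairs/nonneg_face_value.
  exact/nonneg_over_pairings/nonneg_over_shifts/nonneg_red_value.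
apply: le_trans lower _.
rewrite -(total_const c); apply: (@le_trans _ _
  (total c (fun x => K + M * indicator (~~ facets_ok ok x)))).
  apply: ler_total => x; case: (boolP (facets_ok ok x)) => x_ok.
    by rewrite mulr0 addr0; apply: checkP.
  by rewrite mulr1.
by rewrite totalD totalM lerD2l ler_wpM2l // total_facets.
Qed.

End Bound.

(** There are finitely many colourings. The sum of absolute values is a crude bound, but its effect
    vanishes in the limit. *)
Lemma cube4_bounded (f : cube4 -> Z) : exists2 M, 0 <= M & forall x, f x <= M.
Proof.
pose F (g : {ffun bool * bool * bool * bool -> bool}) :=
  f (fun a b e d => g (a, b, e, d)).
exists (\sum_g `|F g|) => [|x]; first by apply: sumr_ge0.
pose g := [ffun p : bool * bool * bool * bool => x p.1.1.1 p.1.1.2 p.1.2 p.2].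
have -> : f x = F g.
  by congr f; do 4![apply/funext => ?]; rewrite ffunE.
rewrite (bigD1 g) //= (le_trans (ler_norm _)) // lerDl.
by apply: sumr_ge0.
Qed.

(** * Passage to the limit *)

Section Limit.
Variable R : realType.

Definition real_of_Z (z : Z) : R := (int_of_Z z)%:~R.

Lemma real_of_ZD : {morph real_of_Z : x y / x + y}.
Proof. by move=> x y; rewrite /real_of_Z !rmorphD. Qed.

Lemma real_of_ZM : {morph real_of_Z : x y / x * y}.
Proof. by move=> x y; rewrite /real_of_Z !rmorphM. Qed.

Lemma real_of_Z_nat m : real_of_Z m%:R = m%:R.
Proof. by rewrite /real_of_Z !rmorph_nat. Qed.

Lemma real_of_Z_ge0 z : 0 <= z -> 0 <= real_of_Z z.
Proof. by rewrite /real_of_Z ler0z; case: z. Qed.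

Lemma ler_real_of_Z x y : x <= y -> real_of_Z x <= real_of_Z y.
Proof.
move=> xy; rewrite -subr_ge0 -[y](subrK x) real_of_ZD addrK.
by apply: real_of_Z_ge0; rewrite subr_ge0.
Qed.

Lemma real_of_Z_gt0 z : 0 < z -> 0 < real_of_Z z.
Proof.
move=> z0; rewrite lt_def real_of_Z_ge0 ?ltW // andbT intr_eq0.
apply: contraTneq z0 => z0; rewrite (_ : z = 0) ?ltxx //.
by apply: (can_inj int_of_ZK); rewrite z0.
Qed.

(** Bad 3-cubes number O(n^2 2^n) among n^3 2^n, so after division by n^4 2^n the error in
    [blue_bound] is O(1/n). *)
Lemma coloured_turan_density_le (Cs : coloured_cube -> Prop) ok cert2 cert0
    (D K : Z) (C : nat) :
  shift3_invariant ok -> check_cubes ok cert2 cert0 D K -> 0 < D -> 0 <= K ->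
  (forall n (k : {ffun hypercube n -> colour}), cc_free Cs (ColouredCube k) ->
     bad_count (fun v => k v == blue) ok <= (C * n ^ 2 * 2 ^ n)%:R) ->
  coloured_turan_density R Cs <= real_of_Z K / (96 * real_of_Z D).
Proof.
move=> okP certP D0 K0 badP.
have [M M_ge0 MP] : exists2 M, 0 <= M &
    forall x, cube_value D (face_table cert2) (red_table cert0) x <= K + M.
  have [M M_ge0 MP] :=
    cube4_bounded (cube_value D (face_table cert2) (red_table cert0)).
  by exists M => // x; apply: le_trans (MP x) _; rewrite lerDr.
have D2 : 0 < 96 * real_of_Z D by rewrite mulr_gt0 ?real_of_Z_gt0.
pose E := real_of_Z M * (8 * C)%:R.
have E_ge0 : 0 <= E by rewrite mulr_ge0 ?real_of_Z_ge0.
have step n : (0 < n)%N -> max_coloured_density R Cs n <=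
    real_of_Z K / (96 * real_of_Z D) + E / (96 * real_of_Z D) / n%:R.
  move=> n_gt0; have n0 : 0 < n%:R :> R by rewrite ltr0n.
  apply: bigmax_le => [|k /asboolP k_free].
    rewrite addr_ge0 // ?divr_ge0 // ?real_of_Z_ge0 //; first exact: ltW.
    exact: ltW.
  have := blue_bound (fun v => k v == blue) okP certP M_ge0 MP.
  move=> /le_trans/(_ (lerD (lexx _) (ler_wpM2l M_ge0
    (ler_wpM2l (ler0n _ _) (badP n k k_free)))))/ler_real_of_Z.
  rewrite !(real_of_ZD, real_of_ZM, real_of_Z_nat) /vertex_density /= card_ord.
  have P0 : 0 < (2 ^ n)%:R :> R by rewrite ltr0n expn_gt0.
  rewrite ler_pdivrMr // /E (natrM _ (16 * n ^ 4)) (natrM _ 16 (n ^ 4)).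
  rewrite (natrM _ (n ^ 4)) (natrM _ (C * n ^ 2)) (natrM _ C (n ^ 2)).
  rewrite (natrM _ 8 n) (natrM _ 8 C) (natrX _ n 4) (natrX _ n 2).
  have := real_of_Z_gt0 D0.
  move: #|_|%:R (2 ^ n)%:R P0 n%:R n0 (real_of_Z M) (real_of_Z K) (real_of_Z D).
  move=> B P P0 N N0 m k' d d0 H.
  (* The factor 96 is the coefficient 6 times the 16 shifts in [total_blue]. *)
  rewrite -(ler_pM2l (_ : 0 < N ^+ 4 * (96 * d))) ?mulr_gt0 ?exprn_gt0 //.
  rewrite (_ : N ^+ 4 * (96 * d) * B = 6 * d * (16 * N ^+ 4 * B)); last by ring.
  apply: le_trans H _; rewrite le_eqVlt; apply/orP; left; apply/eqP.
  by field; rewrite !gt_eqF.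
apply/ler_addgt0Pr => eps eps0; apply: limr_le.
  exact: coloured_turan_density_cvg.
pose e := E / (96 * real_of_Z D).
have e_ge0 : 0 <= e by rewrite divr_ge0 // ltW.
(* From this index on [n] exceeds [e / eps], so the error [e / n] is at most [eps]. *)
exists (Num.truncn (e / eps)).+1 => // n /= lt_n.
have n_gt0 : (0 < n)%N by apply: leq_trans lt_n.
apply: le_trans (step n n_gt0) _; rewrite lerD2l -/e ler_pdivrMr ?ltr0n //.
rewrite mulrC -ler_pdivrMr //; apply: ltW; apply: lt_le_trans (truncnS_gt _) _.
by rewrite ler_nat.
Qed.

End Limit.

(** * Upper bounds *)

Lemma avoids_invariant r : shift3_invariant (avoids r).
Proof.
move=> p q s y; rewrite -[RHS](allb_shift _ p); congr allb; apply/funext => p'.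
rewrite -[RHS](allb_shift _ q); congr allb; apply/funext => q'.
rewrite -[RHS](allb_shift _ s); congr allb; apply/funext => s'.
congr (~~ blue_off _ _); do 3![apply/funext => ?].
by rewrite /shift3 -!addbA.
Qed.

Lemma blue_face_shift p q (x : face) :
  blue_face (fun a b => x (a (+) p) (b (+) q)) = blue_face x.
Proof.
rewrite /blue_face; case: p; case: q => /=;
by case: (x false false); case: (x true false); case: (x false true);
  case: (x true true).
Qed.

Lemma no_blue_face_invariant : shift3_invariant no_blue_face.
Proof.
move=> p q s y; rewrite /no_blue_face /shift3; congr [&& _, _ & _].
- rewrite -[RHS](allb_shift _ s); congr allb; apply/funext => c.
  by rewrite (blue_face_shift p q (fun a b => y a b (c (+) s))).
- rewrite -[RHS](allb_shift _ q); congr allb; apply/funext => b.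
  by rewrite (blue_face_shift p s (fun a c => y a (b (+) q) c)).
- rewrite -[RHS](allb_shift _ p); congr allb; apply/funext => a.
  by rewrite (blue_face_shift q s (fun b c => y (a (+) p) b c)).
Qed.

(** * Counting the bad 3-cubes of a free colouring *)

Section FreeColourings.
Variables (n : nat) (k : {ffun hypercube n -> colour}).
Implicit Types (i j l : 'I_n) (v : hypercube n).
Local Notation c := (fun v => k v == blue).

Lemma subcube_cube_map r i j l v : i != j -> i != l -> j != l ->
  (forall s : hypercube 3, (s : nat) \notin r -> c (cube_map i j l v s)) ->
  subcube (cube3_red r) (ColouredCube k).
Proof.
move=> ij il jl H; exists (cube_map i j l v); split.
- exact: cube_map_inj.
- exact: cube_map_homo.
- move=> s /=; rewrite ffunE; case: ifP => // /negbT sr _.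
  exact/eqP/H.
Qed.

Lemma corner_corner i j l v a b e p q s :
  corner i j l v (a (+) p) (b (+) q) (e (+) s) =
  corner i j l (corner i j l v p q s) a b e.
Proof.
apply: vertex_ext => x; rewrite !digit_corner !andb_addl.
by move: (digit x v) (a && _) (b && _) (e && _) (p && _) (q && _) (s && _);
  do 7!case.
Qed.

(** A translate of the pattern seen from [v] is the pattern itself seen from another corner. *)
Lemma free_avoids r i j l v : ~ subcube (cube3_red r) (ColouredCube k) ->
  i != j -> i != l -> j != l -> avoids r (local3 c i j l v).
Proof.
move=> no_r ij il jl; apply: allbI => p; apply: allbI => q; apply: allbI => s.
apply/negP => /allP H; apply: no_r.
apply: (@subcube_cube_map r i j l (corner i j l v p q s)) => // t tr.
have := H t; rewrite mem_iota ltn_ord (negbTE tr) => /(_ isT) /=.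
by rewrite /local3 corner_corner.
Qed.

Lemma sum_repeated : \sum_(i < n) \sum_(j < n) \sum_(l < n) \sum_(v :
  hypercube n)
  (indicator (i == j) + (indicator (i == l) + indicator (j == l)))
  = (3 * n ^ 2 * 2 ^ n)%:R.
Proof.
have diag (i : 'I_n) (z : Z) : \sum_(j < n) indicator (i == j) * z = z.
  rewrite (bigD1 i) //= eqxx mul1r big1 ?addr0 // => j /negbTE ij.
  by rewrite eq_sym ij mul0r.
have cst (I : finType) (z : Z) : \sum_(i : I) z = #|I|%:R * z.
  by rewrite sumr_const mulr_natl.
transitivity (\sum_(i < n) \sum_(j < n) (indicator (i == j) * (n * 2 ^ n)%:R
    + (2 * 2 ^ n)%:R) : Z).
  apply: eq_bigr => i _; apply: eq_bigr => j _.
  under eq_bigr => l _ do rewrite cst mulrC.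
  rewrite -mulr_suml !big_split /= cst.
  have E (a : 'I_n) : \sum_(l < n) indicator (a == l) = 1.
    by rewrite -[RHS](diag a); apply: eq_bigr => l _; rewrite mulr1.
  rewrite !E !card_ord mulrDl [X in X * _]mulrC -mulrA -natrM; congr (_ + _).
  by rewrite natrM.
under eq_bigr => i _ do rewrite big_split /= diag cst.
rewrite cst !card_ord -natrM -natrD -natrM; congr _%:R.
by rewrite [RHS]mulnC; move: (2 ^ n)%N => P; ring.
Qed.

(** Triples with a repeated direction are all counted as bad, at a cost of [3 * n ^ 2 * 2 ^ n];
    [extra] pays for the others. *)
Lemma bad_count_bound (ok : cube3 -> bool) (extra : 'I_n -> 'I_n -> 'I_n ->
  hypercube n -> Z) (e : nat) :
  (forall i j l v, 0 <= extra i j l v) ->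
  (forall i j l v, i != j -> i != l -> j != l ->
     indicator (~~ ok (local3 c i j l v)) <= extra i j l v) ->
  \sum_i \sum_j \sum_l \sum_v extra i j l v <= (e * n ^ 2 * 2 ^ n)%:R ->
  bad_count c ok <= ((3 + e) * n ^ 2 * 2 ^ n)%:R.
Proof.
move=> extra0 okP extraP.
have -> : ((3 + e) * n ^ 2 * 2 ^ n = 3 * n ^ 2 * 2 ^ n + e * n ^ 2 * 2 ^ n)%N.
  by rewrite -!mulnDl.
rewrite natrD -sum_repeated.
apply: le_trans (lerD (lexx _) extraP).
rewrite -big_split /=; apply: ler_sum => i _.
rewrite -big_split /=; apply: ler_sum => j _.
rewrite -big_split /=; apply: ler_sum => l _.
rewrite -big_split /=; apply: ler_sum => v _.
have ind0 b : 0 <= indicator b by case: b.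
have ind1 b : indicator b <= 1 by case: b.
have [ij|ij] := eqVneq i j.
  by apply: le_trans (ind1 _) _; rewrite -!addrA lerDl !addr_ge0.
have [il|il] := eqVneq i l.
  by apply: le_trans (ind1 _) _; rewrite add0r -!addrA lerDl !addr_ge0.
have [jl|jl] := eqVneq j l.
  by apply: le_trans (ind1 _) _; rewrite !add0r lerDl.
by rewrite !add0r; apply: okP.
Qed.

Lemma bad_count_avoids r : ~ subcube (cube3_red r) (ColouredCube k) ->
  bad_count c (avoids r) <= (3 * n ^ 2 * 2 ^ n)%:R.
Proof.
move=> no_r; apply: (@bad_count_bound _ (fun _ _ _ _ => 0) 0) => //.
  by move=> i j l v ij il jl; rewrite free_avoids.
by rewrite big1 // => i _; rewrite big1 // => j _; rewrite big1 // => l _;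
  rewrite big1.
Qed.

(** Two blue squares on the edge in direction [i] at [v] would form a [B4]. So at most one direction
    [j] other than [i] counts, besides the degenerate [j = i]. *)
Lemma blue_face_degree i v : ~ subcube B4 (ColouredCube k) ->
  \sum_j indicator (blue_face (fun a b => c (toggle a i (toggle b j v)))) <= 2.
Proof.
move=> no_B4; pose A := [set j |
  blue_face (fun a b => c (toggle a i (toggle b j v)))].
have -> : \sum_j indicator (blue_face (fun a b => c (toggle a i (toggle b j
  v))))
    = #|A|%:R.
  rewrite -big_mkcond /= sumr_const; congr (_ *+ _).
  by apply: eq_card => j; rewrite inE.
suff : (#|A| <= 2)%N by rewrite -(ler_nat Z).
rewrite leqNgt; apply/negP => A_gt2.
have /card_gt1P[j [l [jA lA jl]]] : (1 < #|A :\ i|)%N.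
  by rewrite -ltnS; apply: leq_trans A_gt2 _;
    rewrite (cardsD1 i A) -add1n leq_add2r leq_b1.
move: jA lA; rewrite !inE => /andP[ji /and4P[/= v00 v10 v01 v11]].
move=> /andP[li /and4P[/= _ _ w01 w11]].
apply: no_B4; apply: (@subcube_cube_map [:: 5; 7]%N j i l v) => //.
  by rewrite eq_sym.
apply: (@cube_map_cases _ j i l v (fun m w => m \notin _ -> c w));
  split=> //= _.
by rewrite flipC.
Qed.

Lemma sum_blue_faces (Q : 'I_n -> 'I_n -> 'I_n -> hypercube n -> bool) :
  (forall i j v, \sum_l indicator (Q i j l v) <= 2) ->
  \sum_i \sum_j \sum_l \sum_v indicator (Q i j l v) <= (2 * n ^ 2 * 2 ^ n)%:R.
Proof.
move=> QP; apply: (@le_trans _ _ (\sum_(i < n) \sum_(j < n) \sum_(v :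
  hypercube n) 2)).
  apply: ler_sum => i _; apply: ler_sum => j _; rewrite exchange_big /=.
  by apply: ler_sum => v _; apply: QP.
rewrite !sumr_const !card_ord -!mulrnA ler_nat.
by rewrite -!mulnA (mulnC (2 ^ n)%N) !mulnA.
Qed.

End FreeColourings.

(** Without [B5], a 3-cube on distinct directions is bad only through a blue face. Each of its six
    faces costs [2 * n ^ 2 * 2 ^ n], and repeated directions add 3, whence 15. *)
Lemma bad_count_C6 n (k : {ffun hypercube n -> colour}) :
  ~ subcube B4 (ColouredCube k) -> ~ subcube B5 (ColouredCube k) ->
  bad_count (fun v => k v == blue)
    (fun y => avoids [:: 0; 7]%N y && no_blue_face y)
  <= (15 * n ^ 2 * 2 ^ n)%:R.
Proof.
move=> no_B4 no_B5; pose c v := k v == blue.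
pose Q1 e i j l v := indicator (blue_face (fun a b => local3 c i j l v a b e)).
pose Q2 b i j l v := indicator (blue_face (fun a e => local3 c i j l v a b e)).
pose Q3 a i j l v := indicator (blue_face (fun b e => local3 c i j l v a b e)).
have ind0 b : 0 <= indicator b by case: b.
pose extra i j l v := (Q1 false i j l v + Q1 true i j l v) +
  ((Q2 false i j l v + Q2 true i j l v) + (Q3 false i j l v + Q3 true i j l v)).
apply: (@bad_count_bound _ _ _ extra 12) => [i j l v|i j l v ij il jl|].
- by rewrite !addr_ge0 // ind0.
- rewrite (@free_avoids _ _ [:: 0;
  7]%N) //= /extra /Q1 /Q2 /Q3 /no_blue_face /allb.
  by do 6!case: (blue_face _).
have Q1P e : \sum_i \sum_j \sum_l \sum_v Q1 e i j l v <= (2 * n ^ 2 * 2 ^ n)%:R.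
  under eq_bigr => i _ do rewrite exchange_big /=.
  apply: (@sum_blue_faces _ (fun i l j v => _)) => i l v.
  exact: (blue_face_degree i (toggle e l v) no_B4).
have Q2P b : \sum_i \sum_j \sum_l \sum_v Q2 b i j l v <= (2 * n ^ 2 * 2 ^ n)%:R.
  apply: (@sum_blue_faces _ (fun i j l v => _)) => i j v.
  apply: le_trans (blue_face_degree i (toggle b j v) no_B4).
  apply: ler_sum => l _; rewrite le_eqVlt; apply/orP; left; apply/eqP.
  congr (indicator (blue_face _)); do 2![apply/funext => ?].
  by rewrite /local3 /corner /c; congr (k (toggle _ _ _) == _); rewrite toggleC.
have Q3P a : \sum_i \sum_j \sum_l \sum_v Q3 a i j l v <= (2 * n ^ 2 * 2 ^ n)%:R.
  apply: (@sum_blue_faces _ (fun i j l v => _)) => i j v.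
  apply: le_trans (blue_face_degree j (toggle a i v) no_B4).
  apply: ler_sum => l _; rewrite le_eqVlt; apply/orP; left; apply/eqP.
  congr (indicator (blue_face _)); apply/funext => b; apply/funext => e.
  rewrite /local3 /corner /c; congr (k _ == _).
  by rewrite toggleC; congr toggle; rewrite toggleC.
have sumD (F G : 'I_n -> 'I_n -> 'I_n -> hypercube n -> Z) :
    \sum_i \sum_j \sum_l \sum_v (F i j l v + G i j l v) =
    \sum_i \sum_j \sum_l \sum_v F i j l v + \sum_i \sum_j \sum_l \sum_v G i j
      l v.
  rewrite -big_split /=; apply: eq_bigr => i _.
  rewrite -big_split /=; apply: eq_bigr => j _.
  rewrite -big_split /=; apply: eq_bigr => l _.
  by rewrite -big_split.
have -> : (12 * n ^ 2 * 2 ^ n)%:R = (2 * n ^ 2 * 2 ^ n)%:R *+ 6 :> Z.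
  by rewrite -mulrnA; congr _%:R; move: (n ^ 2)%N (2 ^ n)%N => p q; ring.
rewrite /extra !sumD !mulrS mulr0n addr0 -!addrA.
by do !apply: lerD.
Qed.

(** The bounds become identities between integers, which are settled by computation. *)
Lemma density_ratio (R : realType) (D K p q : Z) :
  q * K = p * (96 * D) -> 0 < D -> 0 < q ->
  real_of_Z R K / (96 * real_of_Z R D) = real_of_Z R p / real_of_Z R q.
Proof.
move=> /(congr1 (real_of_Z R)) + /(real_of_Z_gt0 R) D0 /(real_of_Z_gt0 R) q0.
rewrite !real_of_ZM real_of_Z_nat => E.
have d0 : 96 * real_of_Z R D != 0 by rewrite mulf_neq0 ?pnatr_eq0 // gt_eqF.
have {}q0 : real_of_Z R q != 0 by rewrite gt_eqF.
by apply/eqP; rewrite eqr_div // mulrC E.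
Qed.

Theorem theorem1 (R : realType) :
  [/\ (* (i) *)
      vertex_turan_density R (fun F => F = R2)
        = coloured_turan_density R (fun F => F = B3m)
      /\ coloured_turan_density R (fun F => F = B3m) = 2 / 3,
      (* (ii) *)
      [/\ 3 / 4 <= vertex_turan_density R (fun F => F = hypercube 3),
          vertex_turan_density R (fun F => F = hypercube 3)
            = coloured_turan_density R (fun F => F = B3)
        & coloured_turan_density R (fun F => F = B3)
            <= 769 / 1000]
    & (* (iii) *)
      [/\ 1 / 2 <= vertex_turan_density R (fun F => F = C6),
          vertex_turan_density R (fun F => F = C6)
            = coloured_turan_density R (fun F => F = B4 \/ F = B5)
        & coloured_turan_density R (fun F => F = B4 \/ F = B5)
            <= (53 * 1000 + 111) / 10 ^+ 5]].
Proof.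
split.
- have R2_eq := turan_density_eq R free_R2_B3m; split=> //.
  (* The lower bound deletes every third layer, and the certificate gives the upper bound, with the
     constant 3 from repeated directions alone. *)
  apply/eqP; rewrite eq_le; apply/andP; split; last first.
    by rewrite -R2_eq; apply: (@vertex_turan_density_ge R _ 2) => n r;
      apply: off_layers3_free.
  rewrite -[2 / 3]/(2%:R / 3%:R) -!(real_of_Z_nat R).
  rewrite -(@density_ratio R 252000 16128000) //.
  have := @coloured_turan_density_le R (fun F => F = B3m) _ _ _ _ _ 3
    (@avoids_invariant _) R2_check.
  apply=> // n k /cc_freeP k_free; apply: bad_count_avoids.
  exact: (k_free _ erefl).
- split.
  + by apply: (@vertex_turan_density_ge R _ 3) => n r; apply: off_layers4_free.
  + exact: (turan_density_eq R free_Q3_B3).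
  rewrite -!(real_of_Z_nat R) -(@density_ratio R 1296000000 95675904000) //.
  have := @coloured_turan_density_le R (fun F => F = B3) _ _ _ _ _ 3
    (@avoids_invariant _) Q3_check.
  apply=> // n k /cc_freeP k_free; apply: bad_count_avoids.
  exact: (k_free _ erefl).
- split.
  + by apply: (@vertex_turan_density_ge R _ 1) => n r; apply: off_layers2_free.
  + exact: (turan_density_eq R free_C6_B4_B5).
  have -> : (53 * 1000 + 111) / 10 ^+ 5 =
      real_of_Z R (53 * 1000 + 111)%R
      / real_of_Z R (10 * (10 * (10 * (10 * 10))))%R.
    rewrite !(real_of_ZD, real_of_ZM, real_of_Z_nat) !exprS expr0 mulr1.
    by [].
  rewrite -(@density_ratio R 1936000000 98709980160) //.
  have okP : shift3_invariant (fun y => avoids [:: 0; 7]%N y && no_blue_face y).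
    by move=> p q s y; rewrite avoids_invariant no_blue_face_invariant.
  have := @coloured_turan_density_le R (fun F => F = B4 \/ F = B5) _ _ _ _ _ 15
    okP C6_check.
  by apply=> // n k /cc_freeP k_free; apply: bad_count_C6; apply: k_free;
    [left|right].
Qed.
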